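(* Let $n,k$ be positive integers with $\frac{n}{\log n}\leqslant k\leqslant\frac{2n}{\log n+6}$ (equivalently $\frac{1}{\log n}\leqslant\lambda\leqslant\frac{2}{e^3}\cdot\frac{\sqrt n}{\log n+6}$), and put $\rho=n/k$. Then for every fixed integer $N\geqslant 0$, \[ S(n,k)=\sum_{0\leqslant j\leqslant k}(-1)^j\binom{k}{j}\left(\frac{\lambda}{k}\right)^j\left(\sum_{0\leqslant m\leqslant N}\frac{c_m^{[\mathrm{be}]}(j,\rho)}{k^m}\right)+R_N^{[\mathrm{be}]}(n,k), \] where \[ R_N^{[\mathrm{be}]}(n,k)=O_N\left(\left(1-\frac{\lambda}{k}\right)^k\left(\frac{\lambda\log n}{\sqrt n}\right)^{2N+1}\right). \]
   Context: $S(n,k):=\left\{ n \atop k\right\}\frac{k!}{k^n}=\sum_{0\leqslant j\leqslant k}\binom{k}{j}(-1)^j\left(1-\frac jk\right)^n$, where $\left\{ n \atop k\right\}$ is the Stirling number of the second kind; $\lambda:=ke^{-n/k}$. The polynomials $c_m^{[\mathrm{be}]}(x,w)$ are defined by the power series expansion in $t$ \[ (1-xt)^{w/t}e^{xw}=\sum_{m\geqslant 0}c_m^{[\mathrm{be}]}(x,w)\,t^m . \] $O_N$ means the implied constant depends only on $N$; $\log$ is natural. *)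

(* Defs.v *)
From mathcomp Require Import ssreflect ssrfun ssrbool eqtype fintype finset.
From Stdlib Require Import Reals Lra Lia.
From Coquelicot Require Import Coquelicot.

Local Open Scope R_scope.

(* In MathComp a [partition] has no empty block. *)
Definition stirling2 (n k : nat) : nat :=
  #|[set P : {set {set 'I_n}} | partition P [set: 'I_n] & #|P| == k]|.

Definition Snk (n k : nat) : R :=
  INR (stirling2 n k) * INR (Factorial.fact k) / INR k ^ n.

Definition lam (n k : nat) : R := INR k * exp (- (INR n / INR k)).

(* [c m x w] is the coefficient of [t ^ m] in the power series expansion of
   [(1 - x t)^(w/t) e^(x w)].  The function has a removable singularity at
   [t = 0], hence the punctured neighbourhood; near 0 the base [1 - x t] is
   positive, so [Rpower] is the intended power.  By [be_expansion_exists] and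
   [be_expansion_unique] below, exactly one family [c] has this property. *)
Definition be_expansion (c : nat -> R -> R -> R) : Prop :=
  forall x w : R,
    locally' 0 (fun t : R =>
      is_pseries (fun m : nat => c m x w) t
        (Rpower (1 - x * t) (w / t) * exp (x * w))).

Lemma CV_radius_ge_of_bound (a : nat -> R) (M K : R) :
  0 < K -> (forall n, Rabs (a n) <= M * K ^ n) ->
  Rbar_le (/ K) (CV_radius a).
Proof.
move=> HK Ha.
apply (proj1 (CV_radius_bounded a)).
exists M => n.
rewrite Rabs_mult.
have HKn : 0 < K ^ n by apply pow_lt.
have HiKn : 0 < (/ K) ^ n by apply pow_lt, Rinv_0_lt_compat.
rewrite (Rabs_right ((/ K) ^ n)); last by lra.
have -> : M = (M * K ^ n) * (/ K) ^ n.
  by rewrite Rmult_assoc -Rpow_mult_distr Rinv_r ?pow1; lra.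
by apply Rmult_le_compat_r; [lra | apply Ha].
Qed.

(* Logarithmic derivative: the series [c] solves [F' = D F], [F(0) = 1] with
   [D = sum_i be_dlog x w i * t^i]. *)
Definition be_dlog (x w : R) (i : nat) : R :=
  - w * x ^ (i + 2)%nat * (INR (i + 1)%nat / INR (i + 2)%nat).

Fixpoint be_table (x w : R) (m : nat) : nat -> R :=
  match m with
  | O => fun _ => 1
  | S p => fun i =>
      if (i <=? p)%nat then be_table x w p i
      else sum_f_R0 (fun j => be_dlog x w j * be_table x w p (Nat.sub p j)) p
             / INR (S p)
  end.

Definition be_coef (m : nat) (x w : R) : R := be_table x w m m.

Lemma be_table_stable x w p i :
  (i <= p)%nat -> be_table x w p i = be_coef i x w.
Proof.
elim: p => [|p IH] Hi.
  by have -> : i = 0%nat by lia.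
case: (Nat.eq_dec i (S p)) => [->|Hne] //.
have Hip : (i <= p)%nat by lia.
rewrite /= (proj2 (Nat.leb_le i p) Hip).
exact: IH.
Qed.

Lemma be_coef_rec x w :
  forall p, PS_derive (fun m => be_coef m x w) p
            = PS_mult (be_dlog x w) (fun m => be_coef m x w) p.
Proof.
move=> p; rewrite /PS_derive /PS_mult {1}/be_coef.
have E : be_table x w (S p) (S p) =
  sum_f_R0 (fun j => be_dlog x w j * be_table x w p (Nat.sub p j)) p / INR (S p).
  have H : Nat.leb (S p) p = false by apply Nat.leb_gt; lia.
  by rewrite -[LHS]/(if Nat.leb (S p) p then _ else _) H.
rewrite E.
have HS : INR (S p) <> 0 by apply not_0_INR.
rewrite (_ : forall s, INR (S p) * (s / INR (S p)) = s); last by move=> s; field.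
apply sum_eq => j Hj.
by rewrite be_table_stable //; lia.
Qed.

Lemma be_dlog_bound x w X i :
  Rabs x <= X -> Rabs (be_dlog x w i) <= Rabs w * X ^ (i + 2)%nat.
Proof.
move=> HX; rewrite /be_dlog Rabs_mult (Rabs_mult (- w)) Rabs_Ropp.
have H1 : 0 < INR (i + 2)%nat by apply lt_0_INR; lia.
have H2 : 0 <= INR (i + 1)%nat by apply pos_INR.
have H3 : INR (i + 1)%nat <= INR (i + 2)%nat by apply le_INR; lia.
have H4 : Rabs (INR (i + 1)%nat / INR (i + 2)%nat) <= 1.
  rewrite Rabs_pos_eq.
    by apply Rmult_le_reg_r with (INR (i + 2)%nat) => //; field_simplify; lra.
  by apply Rdiv_le_0_compat.
have H5 : Rabs (x ^ (i + 2)%nat) <= X ^ (i + 2)%nat.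
  by rewrite -RPow_abs; apply pow_incr; split; [apply Rabs_pos|].
rewrite -[X in _ <= X]Rmult_1_r.
apply Rmult_le_compat => //; try apply Rabs_pos.
  by apply Rmult_le_pos; apply Rabs_pos.
by apply Rmult_le_compat_l => //; apply Rabs_pos.
Qed.

Lemma be_coef_bound x w X :
  Rabs x <= X ->
  forall m, Rabs (be_coef m x w) <= (X * (1 + Rabs w * X)) ^ m.
Proof.
move=> HX.
have X0 : 0 <= X by apply Rle_trans with (Rabs x) => //; apply Rabs_pos.
have w0 : 0 <= Rabs w by apply Rabs_pos.
set B := 1 + Rabs w * X.
have B1 : 1 <= B by rewrite /B; have := Rmult_le_pos _ _ w0 X0; lra.
move=> m; elim/(well_founded_induction Wf_nat.lt_wf): m => -[|p] IH.
  by rewrite /be_coef /= Rabs_R1; lra.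
have Hr := be_coef_rec x w p.
rewrite /PS_derive in Hr.
have HS : 0 < INR (S p) by apply lt_0_INR; lia.
apply Rmult_le_reg_l with (INR (S p)) => //.
rewrite -{1}(Rabs_pos_eq (INR (S p))); last lra.
rewrite -Rabs_mult Hr /PS_mult.
apply Rle_trans with (1 := Rsum_abs _ _).
apply Rle_trans with (sum_f_R0 (fun _ => (X * B) ^ (S p)) p); last first.
  by rewrite sum_cte Rmult_comm; apply Rle_refl.
apply sum_Rle => j Hj.
rewrite Rabs_mult.
apply Rle_trans with ((Rabs w * X ^ (j + 2)%nat) * (X * B) ^ (p - j)%nat).
  apply Rmult_le_compat; try apply Rabs_pos.
    exact: be_dlog_bound.
  by apply IH; lia.
rewrite !Rpow_mult_distr.
have -> : Rabs w * X ^ (j + 2)%nat * (X ^ (p - j)%nat * B ^ (p - j)%nat)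
   = X ^ S p * (Rabs w * X * B ^ (p - j)%nat).
  have -> : (S p = (j + 1) + (p - j))%nat by lia.
  have -> : (j + 2 = S (j + 1))%nat by lia.
  rewrite pow_add /=; ring.
apply Rmult_le_compat_l; first exact: pow_le.
have Bp : B ^ (p - j)%nat <= B ^ p by apply Rle_pow => //; lia.
have Bp0 : 0 <= B ^ (p - j)%nat by apply pow_le; lra.
rewrite /=; apply Rmult_le_compat => //.
  exact: Rmult_le_pos.
by rewrite /B; lra.
Qed.

Lemma const_of_derive_0 (f : R -> R) (r : R) :
  (forall t, Rabs t < r -> is_derive f t 0) ->
  forall t, Rabs t < r -> f t = f 0.
Proof.
move=> Hf t Ht.
have Hseg : forall s, Rmin 0 t <= s <= Rmax 0 t -> is_derive f s 0.
  move=> s Hs; apply: Hf.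
  move: Hs; rewrite /Rmin /Rmax; case: (Rle_dec 0 t) => H0 Hs;
    move: Ht; rewrite /Rabs; case: (Rcase_abs t) => ?;
    case: (Rcase_abs s) => ?; lra.
case: (Rtotal_order t 0) => [Hlt|[->//|Hgt]].
  apply: (@eq_is_derive R_NormedModule) => // s Hs; apply: Hseg.
  by rewrite Rmin_right ?Rmax_left; lra.
symmetry; apply: (@eq_is_derive R_NormedModule) => // s Hs; apply: Hseg.
by rewrite Rmin_left ?Rmax_right; lra.
Qed.

Lemma PSeries_log (x X t : R) :
  0 < X -> Rabs x <= X -> Rabs t < / X ->
  PSeries (PS_Int (fun i => x ^ S i)) t = - ln (1 - x * t).
Proof.
move=> X0 HX Ht.
have Hrad : forall s, Rabs s < / X ->
    Rbar_lt (Rabs s) (CV_radius (fun i => x ^ S i)).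
  move=> s Hs; apply: Rbar_lt_le_trans (_ : Rbar_le (/ X) _) => //.
  apply (CV_radius_ge_of_bound _ X X) => // n.
  rewrite -RPow_abs; apply (pow_incr _ _ (S n)); split=> //; exact: Rabs_pos.
have Hxs : forall s, Rabs s < / X -> Rabs (x * s) < 1.
  move=> s Hs; rewrite Rabs_mult.
  apply Rle_lt_trans with (X * Rabs s).
    by apply Rmult_le_compat_r => //; apply Rabs_pos.
  by rewrite -(Rinv_r X); [apply Rmult_lt_compat_l | lra].
pose h s := PSeries (PS_Int (fun i => x ^ S i)) s + ln (1 - x * s).
have H : h t = h 0.
  apply (const_of_derive_0 h (/ X)) => // s Hs.
  have Hs1 : 0 < 1 - x * s by have := Rabs_def2 _ _ (Hxs s Hs); lra.
  have D1 : is_derive (PSeries (PS_Int (fun i => x ^ S i))) s (x / (1 - x * s)).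
    have -> : x / (1 - x * s) =
        PSeries (PS_derive (PS_Int (fun i => x ^ S i))) s.
      symmetry.
      rewrite (PSeries_ext _ (PS_scal x (fun i => x ^ i))); last first.
        move=> n; rewrite /PS_derive /PS_Int.
        have HS : INR (S n) <> 0 by apply: not_0_INR.
        have -> : PS_scal x (fun i => x ^ i) n = x * x ^ n by [].
        rewrite -[x ^ S n]/(x * x ^ n); field; exact: HS.
      rewrite PSeries_scal /Rdiv; congr (_ * _).
      apply is_series_unique.
      apply: is_series_ext (is_series_geom _ (Hxs s Hs)) => n.
      by rewrite Rpow_mult_distr.
    apply: is_derive_PSeries; rewrite CV_radius_Int; exact: Hrad.
  have D2 : is_derive (fun s => ln (1 - x * s)) s (- (x / (1 - x * s))).
    auto_derive; first lra.
    field; lra.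
  have := is_derive_plus _ _ _ _ _ D1 D2.
  by rewrite /plus /= Rplus_opp_r.
move: H; rewrite /h PSeries_0 Rmult_0_r Rminus_0_r ln_1 /=; lra.
Qed.

Lemma be_coef_expansion : be_expansion be_coef.
Proof.
move=> x w.
set X := Rabs x + 1; set K := X * (1 + Rabs w * X).
have X1 : 1 <= X by rewrite /X; have := Rabs_pos x; lra.
have HX : Rabs x <= X by rewrite /X; lra.
have w0 := Rabs_pos w.
have KX : X <= K.
  by rewrite /K; have := Rmult_le_pos X (Rabs w * X);
     have := Rmult_le_pos (Rabs w) X; nra.
have iKX : / K <= / X by apply Rinv_le_contravar; lra.
have K0 : 0 < / K by apply Rinv_0_lt_compat; lra.
exists (mkposreal _ K0) => t Ht t0.
have {}Ht : Rabs t < / K.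
  by move: Ht; rewrite /ball /= /AbsRing_ball /abs /minus /plus /opp /= Ropp_0
     Rplus_0_r.
set c := fun m => be_coef m x w.
set d := be_dlog x w; set g := PS_Int d.
have Rc : forall s, Rabs s < / K -> Rbar_lt (Rabs s) (CV_radius c).
  move=> s Hs; apply: Rbar_lt_le_trans (_ : Rbar_le (/ K) _) => //.
  apply (CV_radius_ge_of_bound _ 1 K) => [|n]; first lra.
  by rewrite Rmult_1_l; apply: be_coef_bound.
have Rd : forall s, Rabs s < / K -> Rbar_lt (Rabs s) (CV_radius d).
  move=> s Hs; apply: Rbar_lt_le_trans (_ : Rbar_le (/ X) _) => //=; first lra.
  apply (CV_radius_ge_of_bound _ (Rabs w * X ^ 2) X) => [|n]; first lra.
  apply: Rle_trans (be_dlog_bound _ _ _ _ HX) _.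
  rewrite pow_add; lra.
have Rg : forall s, Rabs s < / K -> Rbar_lt (Rabs s) (CV_radius g).
  by move=> s Hs; rewrite CV_radius_Int; apply: Rd.
have DF : forall s, Rabs s < / K ->
    is_derive (PSeries c) s (PSeries d s * PSeries c s).
  move=> s Hs; rewrite -PSeries_mult; [|exact: Rd|exact: Rc].
  rewrite -(PSeries_ext _ _ _ (be_coef_rec x w)).
  by apply: is_derive_PSeries; apply: Rc.
have DG : forall s, Rabs s < / K -> is_derive (PSeries g) s (PSeries d s).
  move=> s Hs.
  have -> : PSeries d s = PSeries (PS_derive g) s.
    apply: PSeries_ext => n; rewrite /g /PS_derive /PS_Int.
    field; exact: not_0_INR.
  by apply: is_derive_PSeries; apply: Rg.
have FG : PSeries c t = exp (PSeries g t).
  pose h s := PSeries c s * exp (- PSeries g s).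
  have H : h t = h 0.
    apply (const_of_derive_0 h (/ K)) => // s Hs.
    have D1 := DF s Hs; have D2 := DG s Hs.
    have E1 : ex_derive (PSeries c) s by eexists; exact: D1.
    have E2 : ex_derive (PSeries g) s by eexists; exact: D2.
    rewrite /h; auto_derive => //.
    rewrite (is_derive_unique _ _ _ D1) (is_derive_unique _ _ _ D2).
    ring.
  move: H; rewrite /h !PSeries_0 /c /g /be_coef /= Ropp_0 exp_0 -/c -/g => H.
  rewrite exp_Ropp in H.
  have := exp_pos (PSeries g t) => He.
  apply Rmult_eq_reg_r with (/ exp (PSeries g t)); last first.
    by apply Rinv_neq_0_compat; lra.
  rewrite H; field; lra.
have Gt : PSeries g t = w / t * ln (1 - x * t) + x * w.
  set p := PS_Int (fun i => x ^ S i).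
  have Lp : PSeries p t = - ln (1 - x * t).
    by apply: (PSeries_log x X); lra.
  have Rp : Rbar_lt (Rabs t) (CV_radius p).
    rewrite CV_radius_Int; apply: Rbar_lt_le_trans (_ : Rbar_le (/ X) _) => //=; first lra.
    apply (CV_radius_ge_of_bound _ X X) => [|n]; first lra.
    rewrite -[x * x ^ n]/(x ^ S n) -RPow_abs; apply (pow_incr _ _ (S n)); split=> //; exact: Rabs_pos.
  have Ep1 := PSeries_decr_1 p t (CV_radius_inside _ _ Rp).
  have Ep2 : PSeries (PS_decr_1 p) t =
      x + t * PSeries (PS_decr_1 (PS_decr_1 p)) t.
    rewrite PSeries_decr_1; first by congr (_ + _); rewrite /PS_decr_1 /p /=; field.
    by apply: CV_radius_inside; rewrite CV_radius_decr_1.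
  have Eg := PSeries_decr_1 g t (CV_radius_inside _ _ (Rg t Ht)).
  have E : PSeries (PS_decr_1 g) t =
      - w * PSeries (PS_decr_1 (PS_decr_1 p)) t.
    rewrite -PSeries_scal; apply: PSeries_ext => n.
    have -> : forall u, PS_scal (- w) u n = - w * u n by [].
    rewrite /PS_decr_1 /g /p /d /PS_Int /be_dlog.
    rewrite (_ : (n + 1 = S n)%nat); last lia.
    rewrite (_ : (n + 2 = S (S n))%nat); last lia.
    field.
    by split; apply: not_0_INR.
  rewrite Eg E /= /g /=.
  have E3 : ln (1 - x * t) =
      - (t * (x + t * PSeries (PS_decr_1 (PS_decr_1 p)) t)).
    by rewrite -Ep2; move: Ep1; rewrite Lp {1}/p /=; lra.
  rewrite E3; field; exact: t0.
have -> : Rpower (1 - x * t) (w / t) * exp (x * w) = PSeries c t.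
  by rewrite FG Gt exp_plus.
by apply: PSeries_correct; apply: CV_radius_inside; apply: Rc.
Qed.

Lemma be_expansion_exists : exists c, be_expansion c.
Proof. by exists be_coef; apply: be_coef_expansion. Qed.

Lemma CV_radius_pos_of_punctured (a : nat -> R) (e : posreal) :
  (forall t, Rabs t < e -> t <> 0 -> ex_pseries a t) ->
  Rbar_lt 0 (CV_radius a).
Proof.
move=> Ha.
have e0 := cond_pos e.
have He : Rabs (e / 2) = e / 2 by apply Rabs_pos_eq; lra.
case: (Rbar_lt_dec 0 (CV_radius a)) => // H.
have H1 : Rbar_lt (CV_radius a) (Rabs (e / 2)).
  apply: Rbar_le_lt_trans (_ : Rbar_le _ 0) _; first exact: Rbar_not_lt_le.
  by rewrite He /=; lra.
case: (CV_disk_outside _ _ H1).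
apply ex_series_lim_0.
have [l Hl] : ex_pseries a (e / 2) by apply: Ha; rewrite ?He; lra.
by exists l; apply (proj1 (is_pseries_R _ _ _)).
Qed.

Lemma be_expansion_unique c c' :
  be_expansion c -> be_expansion c' -> forall m x w, c m x w = c' m x w.
Proof.
move=> Hc Hc' m x w.
have [e1 H1] := Hc x w; have [e2 H2] := Hc' x w.
set a := fun m => c m x w; set a' := fun m => c' m x w.
have e0 : 0 < Rmin e1 e2 by apply Rmin_pos; apply cond_pos.
have Hb : forall (e : posreal) t, Rabs t < e -> ball 0 e t.
  by move=> e t; rewrite /ball /= /AbsRing_ball /abs /minus /plus /opp /= Ropp_0
     Rplus_0_r.
have Ra : Rbar_lt 0 (CV_radius a).
  apply (CV_radius_pos_of_punctured _ e1) => t Ht t0.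
  by eexists; apply: H1 => //; apply: Hb.
have Ra' : Rbar_lt 0 (CV_radius a').
  apply (CV_radius_pos_of_punctured _ e2) => t Ht t0.
  by eexists; apply: H2 => //; apply: Hb.
have Heq : forall t, Rabs t < Rmin e1 e2 -> t <> 0 ->
    PSeries a t = PSeries a' t.
  move=> t Ht t0.
  have Ht1 : Rabs t < e1 by apply Rlt_le_trans with (1 := Ht); apply Rmin_l.
  have Ht2 : Rabs t < e2 by apply Rlt_le_trans with (1 := Ht); apply Rmin_r.
  rewrite (is_pseries_unique _ _ _ (H1 t (Hb _ _ Ht1) t0)).
  by rewrite (is_pseries_unique _ _ _ (H2 t (Hb _ _ Ht2) t0)).
change (a m = a' m).
apply PSeries_ext_recip => //.
have Rabs00 : Rabs 0 = 0 by rewrite Rabs_R0.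
have Heq0 : PSeries a 0 = PSeries a' 0.
  have C1 : filterlim (PSeries a) (at_right 0) (locally (PSeries a 0)).
    apply: filterlim_filter_le_1 (_ : filterlim _ (locally 0) _).
      by move=> P [d Hd]; exists d => y Hy _; apply: Hd.
    by apply continuity_pt_filterlim, PSeries_continuity; rewrite Rabs00.
  have C2 : filterlim (PSeries a') (at_right 0) (locally (PSeries a' 0)).
    apply: filterlim_filter_le_1 (_ : filterlim _ (locally 0) _).
      by move=> P [d Hd]; exists d => y Hy _; apply: Hd.
    by apply continuity_pt_filterlim, PSeries_continuity; rewrite Rabs00.
  apply (filterlim_locally_unique (PSeries a) _ _ C1).
  apply: filterlim_ext_loc C2.
  exists (mkposreal _ e0) => y Hy y0; symmetry; apply: Heq; last lra.
  by move: Hy; rewrite /ball /= /AbsRing_ball /abs /minus /plus /opp /= Ropp_0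
     Rplus_0_r.
exists (mkposreal _ e0) => y Hy.
case: (Req_dec y 0) => [->|y0] //.
apply: Heq => //.
by move: Hy; rewrite /ball /= /AbsRing_ball /abs /minus /plus /opp /= Ropp_0
   Rplus_0_r.
Qed.

(* Main.v *)
Require Import Defs.
From mathcomp Require Import ssreflect.
From mathcomp Require all_boot.
From Stdlib Require Import Reals Lra Lia.
From Coquelicot Require Import Coquelicot.
Local Open Scope R_scope.

(** Put [q = lambda/k = e^(-rho)], [s = q/(1-q)], and let [f(j)] be
    [(1-j/k)^n e^(j rho)] minus the truncated sum of the [c_m(j,rho)/k^m].
    The remainder is [sum_j C(k,j) (-q)^j f(j)], and Newton's expansion of [f]
    turns it into [(1-q)^k sum_r C(k,r) (-s)^r D^r f(0)], which extracts the
    factor [(1-q)^k].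

    Take [r0] of order [lambda + log n] and [m >= r0 + k s] of the same order.
    For [r <= r0] one has [C(k,r) s^r <= C(m,r)]; moreover the finite
    differences of [c_i] are bounded by those of the coefficients [b_i] of
    [(1-xt)^(-rho x)], all of which are nonnegative.  Newton's expansion, read
    backwards at [m], bounds this part of the sum by the tail
    [sum_(i>N) b_i(m)/k^i], of order [(rho m^2/k)^(N+1)].
    For [r > r0 >= 2N] the truncated sum, a polynomial of degree [2N] in [j],
    is annihilated by [D^r], and [|D^r f(0)| <= 2^r] since
    [0 <= (1-j/k)^n e^(j rho) <= 1]; this part is at most
    [e^(6ks-r0) <= n^(-N-1)]. *)

(** * Finite differences *)

(** The difference is applied to the function argument, so inductions on [r] generalize over [f] and
    [diff_delta] holds by computation; [diff_S] is the outer form. *)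
Fixpoint diff (r : nat) (f : nat -> R) : nat -> R :=
  match r with
  | O => f
  | S r => diff r (fun x => f (S x) - f x)
  end.

Lemma diff_delta r f x : diff (S r) f x = diff r (fun y => f (S y) - f y) x.
Proof. by []. Qed.

Lemma diff_ext_le r f g x :
  (forall y, (x <= y <= x + r)%nat -> f y = g y) -> diff r f x = diff r g x.
Proof.
elim: r f g => [|r IH] f g H /=; first by apply: H; lia.
by apply: IH => y Hy; rewrite !H //; lia.
Qed.

Lemma diff_ext r f g x : (forall y, f y = g y) -> diff r f x = diff r g x.
Proof. by move=> H; apply: diff_ext_le => y _. Qed.

Lemma diff_plus r f g x :
  diff r (fun y => f y + g y) x = diff r f x + diff r g x.
Proof.
elim: r f g => [|r IH] f g //=.
by rewrite -IH; apply: diff_ext => y; ring.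
Qed.

Lemma diff_scal r a f x : diff r (fun y => a * f y) x = a * diff r f x.
Proof.
elim: r f => [|r IH] f //=.
by rewrite -IH; apply: diff_ext => y; ring.
Qed.

Lemma diff_minus r f g x :
  diff r (fun y => f y - g y) x = diff r f x - diff r g x.
Proof.
rewrite (diff_ext _ _ (fun y => f y + (-1) * g y)); last by move=> y; ring.
by rewrite diff_plus diff_scal; ring.
Qed.

Lemma diff_sum r (f : nat -> nat -> R) n x :
  diff r (fun y => sum_f_R0 (fun i => f i y) n) x
  = sum_f_R0 (fun i => diff r (f i) x) n.
Proof. by elim: n => [|n IH] //=; rewrite diff_plus IH. Qed.

Lemma diff_shift r f x : diff r (fun y => f (S y)) x = diff r f (S x).
Proof. by elim: r f => [|r IH] f //=; rewrite -IH. Qed.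

Lemma diff_S r f x : diff (S r) f x = diff r f (S x) - diff r f x.
Proof. by rewrite /= diff_minus diff_shift. Qed.

Lemma diff_0_of_le r d f :
  (forall x, diff d f x = 0) -> (d <= r)%nat -> forall x, diff r f x = 0.
Proof.
move=> H; elim: r => [|r IH] Hd x; first by have E : d = 0%nat by [lia]; subst.
case: (Nat.eq_dec d (S r)) => [<-|?] //.
by rewrite diff_S !IH; [ring|lia..].
Qed.

Lemma Rabs_diff_le r f x M :
  (forall y, (x <= y <= x + r)%nat -> Rabs (f y) <= M) ->
  Rabs (diff r f x) <= 2 ^ r * M.
Proof.
elim: r f M => [|r IH] f M H /=; first by rewrite Rmult_1_l; apply: H; lia.
rewrite (_ : 2 * 2 ^ r * M = 2 ^ r * (M + M)); last ring.
apply: IH => y Hy.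
apply: Rle_trans (Rabs_triang _ _) _; rewrite Rabs_Ropp.
by apply: Rplus_le_compat; [apply: (H (S y))|apply: H]; lia.
Qed.

Lemma is_lim_seq_diff r (u : nat -> nat -> R) (f : nat -> R) x :
  (forall y, (x <= y <= x + r)%nat -> is_lim_seq (fun m => u m y) (f y)) ->
  is_lim_seq (fun m => diff r (u m) x) (diff r f x).
Proof.
elim: r u f => [|r IH] u f H /=; first by apply: H; lia.
apply: (IH (fun m y => u m (S y) - u m y)) => y Hy.
by apply: is_lim_seq_minus'; apply: H; lia.
Qed.

(** * Newton's expansion and binomial sums *)

Lemma binom_n_0 n : Binomial.C n 0 = 1.
Proof. by rewrite /Binomial.C Nat.sub_0_r /=; field; apply: INR_fact_neq_0. Qed.

Lemma binom_n_n n : Binomial.C n n = 1.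
Proof. by rewrite /Binomial.C Nat.sub_diag /=; field; apply: INR_fact_neq_0. Qed.

(** Pascal's rule in summed form; it is the induction step of the next three lemmas. *)
Lemma sum_pascal k (u : nat -> R) :
  sum_f_R0 (fun j => Binomial.C (S k) j * u j) (S k)
  = sum_f_R0 (fun j => Binomial.C k j * (u j + u (S j))) k.
Proof.
rewrite decomp_sum; last lia.
rewrite /Nat.pred binom_n_0.
case: k => [|k]; first by rewrite /= binom_n_n binom_n_0; ring.
rewrite [sum_f_R0 _ (S k)]tech5 binom_n_n.
rewrite (sum_eq (fun j => Binomial.C (S k) j * _)
  (fun j => Binomial.C (S k) j * u j + Binomial.C (S k) j * u (S j))); last by move=> *; ring.
rewrite sum_plus.
rewrite (decomp_sum (fun j => Binomial.C (S k) j * u j)); last lia.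
rewrite (tech5 (fun j => Binomial.C (S k) j * u (S j))) /Nat.pred binom_n_0 binom_n_n.
rewrite (sum_eq (fun i => Binomial.C (S (S k)) (S i) * u (S i))
  (fun i => Binomial.C (S k) (S i) * u (S i) + Binomial.C (S k) i * u (S i))).
  by rewrite sum_plus; ring.
by move=> i Hi; rewrite -pascal; [ring|lia].
Qed.

(** Induction on [k] for all [f]: [f (S k)] is [f k] plus the first difference of [f] at [k], and
    both terms expand. *)
Lemma newton_expansion k f :
  f k = sum_f_R0 (fun r => Binomial.C k r * diff r f 0) k.
Proof.
elim: k f => [|k IH] f.
  by rewrite /= binom_n_0; ring.
rewrite sum_pascal.
have -> : f (S k) = f k + (f (S k) - f k) by ring.
rewrite (IH (fun x => f (S x) - f x)) (IH f) -sum_plus.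
by apply: sum_eq => r _ /=; ring.
Qed.

(** By Pascal's rule, differencing [f] shifts the coefficient sequence by one; evaluation at 0 then
    reads off [a r]. *)
Lemma newton_unique (a : nat -> R) f :
  (forall x, f x = sum_f_R0 (fun i => Binomial.C x i * a i) x) ->
  forall r, a r = diff r f 0.
Proof.
move=> H r; elim: r a f H => [|r IH] a f H.
  by rewrite /= H /= binom_n_0; ring.
apply: (IH (fun i => a (S i))) => x.
rewrite !H sum_pascal -minus_sum; apply: sum_eq => i _; ring.
Qed.

(** With the shift E = 1 + D, this is (1 + yE)^k = ((1 + y) + yD)^k applied to [f] at 0. *)
Lemma binomial_sum_diff k y f :
  sum_f_R0 (fun j => Binomial.C k j * (y ^ j * f j)) k
  = sum_f_R0 (fun r => Binomial.C k r * (y ^ r * (1 + y) ^ (k - r) * diff r f 0)) k.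
Proof.
elim: k f => [|k IH] f; first by rewrite /=; ring.
rewrite !sum_pascal.
rewrite (sum_eq _ (fun j => Binomial.C k j * (y ^ j * f j) * (1 + y)
   + Binomial.C k j * (y ^ j * (f (S j) - f j)) * y)); last by move=> j _ /=; ring.
rewrite sum_plus -!scal_sum (IH f) (IH (fun x => f (S x) - f x)).
rewrite !scal_sum -sum_plus; apply: sum_eq => r Hr.
rewrite Nat.sub_succ Nat.sub_succ_l //=; ring.
Qed.

(** * The alternating sum for Stirling numbers *)

Module Kernel.
Import all_boot.
Local Open Scope nat_scope.

Section Kernel.
Variables (n x : nat) (P : {set {set 'I_n}}).
Hypothesis partP : partition P [set: 'I_n].

Let covP i : i \in cover P.
Proof. by rewrite (cover_partition partP) inE. Qed.

Let tiP : trivIset P.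
Proof. by case/and3P: partP. Qed.

Lemma preim_partition_eqP (f : 'I_n -> 'I_x) :
  reflect (forall i j, (f i == f j) = (pblock P i == pblock P j))
    (preim_partition f [set: 'I_n] == P).
Proof.
apply: (iffP eqP) => [E i j|H].
  rewrite eq_pblock // -E pblock_equivalence_partition ?inE //.
  by split=> // /eqP ->.
rewrite -[RHS](preim_partition_pblock partP).
by apply: eq_imset => i; apply/setP=> j; rewrite !inE H.
Qed.

Let block i : {B | B \in P} := exist _ (pblock P i) (pblock_mem (covP i)).

Let block_eq i j : (block i == block j) = (pblock P i == pblock P j).
Proof. by rewrite -val_eqE. Qed.

Let block_surj (B : {B | B \in P}) : exists i, block i == B.
Proof.
case: B => B PB.
have /set0Pn[i Bi] : B != set0.
  by apply: contraTneq PB => ->; case/and3P: partP.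
by exists i; apply/eqP/val_inj/def_pblock.
Qed.

(** Composition with [block] is a bijection from the injections of the set of blocks into ['I_x]
    onto the functions with kernel [P]. *)
Lemma card_kernel_eq :
  #|[set f : {ffun 'I_n -> 'I_x} | preim_partition f [set: 'I_n] == P]| = x ^_ #|P|.
Proof.
pose Phi (g : {ffun {B | B \in P} -> 'I_x}) := [ffun i : 'I_n => g (block i)].
have injPhi : injective Phi.
  move=> g h /ffunP E; apply/ffunP=> B; have [i /eqP <-] := block_surj B.
  by have := E i; rewrite !ffunE.
rewrite -[x in RHS]card_ord -[#|P|](card_sig (mem P)) -card_inj_ffuns.
rewrite -(card_imset _ injPhi); apply/esym/eq_card=> f.
rewrite !inE; apply/imsetP/preim_partition_eqP => [[g]|H].
  rewrite inE => /injectiveP injg -> i j.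
  by rewrite !ffunE (inj_eq injg) block_eq.
(* A chosen representative of each block inverts [Phi]. *)
pose rep B := xchoose (block_surj B).
have repK B : block (rep B) = B by apply/eqP/(xchooseP (block_surj B)).
exists [ffun B => f (rep B)].
  rewrite inE; apply/injectiveP=> B C; rewrite !ffunE => /eqP.
  by rewrite H -block_eq !repK => /eqP.
by apply/ffunP=> i; rewrite !ffunE; apply/eqP; rewrite H -block_eq repK.
Qed.

End Kernel.

(** Count the functions from ['I_n] to ['I_x] by their kernel: a kernel with i blocks is shared by
    [x ^_ i] of them. *)
Lemma expn_stirling2 (n x : nat) :
  x ^ n = \sum_(i < x.+1) stirling2 n i * x ^_ i.
Proof.
rewrite -[n in LHS]card_ord -[x in LHS]card_ord -card_ffun -sum1_card.
pose ker (f : {ffun 'I_n -> 'I_x}) := preim_partition f [set: 'I_n].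
rewrite (partition_big ker (fun P => partition P [set: 'I_n])) /=; last first.
  by move=> f _; apply: preim_partitionP.
transitivity (\sum_(P : {set {set 'I_n}} | partition P [set: 'I_n]) x ^_ #|P|).
  by apply: eq_bigr => P partP; rewrite -((card_kernel_eq n x P partP)) -sum1dep_card.
(* Partitions with more than [x] blocks drop out because the falling factorial vanishes; the others
   can be grouped by [inord #|P|]. *)
rewrite (bigID (fun P : {set {set 'I_n}} => #|P| <= x)) /= [X in _ + X]big1 ?addn0; last first.
  by move=> P /andP[_]; rewrite -ltnNge => /ffact_small.
rewrite (partition_big (fun P : {set {set 'I_n}} => inord #|P| : 'I_x.+1) xpredT) //=.
apply: eq_bigr => i _; rewrite /stirling2 -sum1_card big_distrl /=.
rewrite (eq_bigl (fun P : {set {set 'I_n}} => (partition P [set: 'I_n]) && (#|P| == i))).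
  rewrite [RHS](eq_bigl (fun P : {set {set 'I_n}} => (partition P [set: 'I_n]) && (#|P| == i))).
    by apply: eq_bigr => P /andP[_ /eqP ->]; rewrite mul1n.
  by move=> P; rewrite inE.
move=> P; rewrite -andbA; congr andb; apply/andP/eqP => [[leP /eqP <-]|->].
  by rewrite inordK.
by split; [rewrite -ltnS|apply/eqP/val_inj; rewrite /= inordK].
Qed.

Local Open Scope R_scope.

(** The same count in Newton form, so that [newton_unique] identifies i! times the Stirling number
    as a finite difference of x^n. *)
Lemma INR_expn_stirling2 (n x : nat) :
  INR x ^ n =
  sum_f_R0 (fun i => Binomial.C x i * (INR (stirling2 n i) * INR (Factorial.fact i))) x.
Proof.
have INR_expn m : INR (x ^ m)%N = INR x ^ m.
  by elim: m => [|m IH] //; rewrite expnS mult_INR IH.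
have INR_sum (F : nat -> nat) m :
    INR (\sum_(i < m.+1) F i)%N = sum_f_R0 (fun i => INR (F i)) m.
  elim: m => [|m IH]; first by rewrite big_ord_recr big_ord0.
  by rewrite big_ord_recr plus_INR /= IH.
have factE m : m`! = Factorial.fact m.
  by elim: m => [|m IH] //; rewrite factS IH.
rewrite -INR_expn expn_stirling2 (INR_sum (fun i => stirling2 n i * x ^_ i)%N).
apply: PartSum.sum_eq => i /leP lei.
rewrite mult_INR; have := ffact_fact lei; rewrite !factE => /(f_equal INR).
rewrite mult_INR /Binomial.C -[(x - i)%coq_nat]/(x - i)%N => <-.
field; split; exact: INR_fact_neq_0.
Qed.

End Kernel.

Lemma sum_f_R0_rev (f : nat -> R) n :
  sum_f_R0 (fun i => f (n - i)%nat) n = sum_f_R0 f n.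
Proof.
elim: n f => [|n IH] f //.
rewrite decomp_sum; last lia.
rewrite tech5 Nat.sub_0_r /Nat.pred -(IH f) Rplus_comm.
by congr (_ + _); apply: sum_eq => i Hi; congr f.
Qed.

(** k! times the Stirling number is D^k x^n at 0; expand it, reverse j to k - j and divide by
    k^n. *)
Lemma Snk_alternating_sum n k : (0 < k)%nat ->
  Snk n k = sum_f_R0 (fun j => Binomial.C k j * ((-1) ^ j * (1 - INR j / INR k) ^ n)) k.
Proof.
move=> Hk; have k0 : INR k <> 0 by apply: not_0_INR; lia.
rewrite /Snk (newton_unique (fun i => INR (stirling2 n i) * INR (Factorial.fact i))
  (fun x => INR x ^ n)); last by move=> x; exact: Kernel.INR_expn_stirling2.
have H := binomial_sum_diff k (-1) (fun x => INR x ^ n).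
have {}H : sum_f_R0 (fun j => Binomial.C k j * ((-1) ^ j * INR j ^ n)) k
    = (-1) ^ k * diff k (fun x => INR x ^ n) 0.
  (* At y = -1 the terms with r < k contain 0^(k-r), so only r = k survives. *)
  rewrite H; case: (k) => [|p]; first by rewrite /= binom_n_0; ring.
  rewrite tech5 sum_eq_R0; last first.
    move=> i Hi; rewrite Rplus_opp_r pow_i; first ring; lia.
  by rewrite Nat.sub_diag binom_n_n pow_O; ring.
have -> : diff k (fun x => INR x ^ n) 0 =
    (-1) ^ k * sum_f_R0 (fun j => Binomial.C k j * ((-1) ^ j * INR j ^ n)) k.
  rewrite H -Rmult_assoc -Rpow_mult_distr (_ : -1 * -1 = 1) ?pow1; ring.
rewrite -sum_f_R0_rev scal_sum /Rdiv Rmult_comm scal_sum.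
apply: sum_eq => j Hj.
rewrite -pascal_step1 // minus_INR //.
have -> : 1 - INR j * / INR k = (INR k - INR j) * / INR k by field.
have -> : (-1) ^ j = (-1) ^ (k - j) * (-1) ^ k.
  have E : (k = k - j + j)%nat by lia.
  rewrite {2}E pow_add -Rmult_assoc -Rpow_mult_distr (_ : -1 * -1 = 1) ?pow1; ring.
rewrite Rpow_mult_distr pow_inv; ring.
Qed.

(** * Majorants for finite differences *)

(** All orders are compared, so every difference of [h] is nonnegative. This makes the relation
    stable under products and usable in Newton's expansion, whose weights are nonnegative. *)
Definition dominated (f h : nat -> R) : Prop :=
  forall r x, Rabs (diff r f x) <= diff r h x.

Lemma dominated_ext f f' h h' :
  (forall x, f x = f' x) -> (forall x, h x = h' x) ->
  dominated f h -> dominated f' h'.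
Proof.
by move=> E E' H r x; rewrite -(diff_ext _ _ _ _ E) -(diff_ext _ _ _ _ E').
Qed.

Lemma diff_const r a x : diff (S r) (fun _ => a) x = 0.
Proof.
elim: r x => [|r IH] x; first by rewrite /=; ring.
by rewrite diff_S !IH; ring.
Qed.

Lemma dominated_const a A : Rabs a <= A -> dominated (fun _ => a) (fun _ => A).
Proof. by move=> H [|r] x; rewrite ?diff_const ?Rabs_R0 //; apply: Rle_refl. Qed.

Lemma dominated_INR : dominated INR INR.
Proof.
move=> [|r] x; first by rewrite /= Rabs_pos_eq; [apply: Rle_refl|apply: pos_INR].
rewrite diff_delta (diff_ext _ _ (fun _ => 1)); last by move=> y; rewrite S_INR; ring.
by apply: dominated_const; rewrite Rabs_R1; apply: Rle_refl.
Qed.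

Lemma dominated_plus f g F G :
  dominated f F -> dominated g G ->
  dominated (fun x => f x + g x) (fun x => F x + G x).
Proof.
move=> Hf Hg r x; rewrite !diff_plus.
by apply: Rle_trans (Rabs_triang _ _) _; apply: Rplus_le_compat.
Qed.

Lemma dominated_sum (f h : nat -> nat -> R) n :
  (forall i, (i <= n)%nat -> dominated (f i) (h i)) ->
  dominated (fun x => sum_f_R0 (fun i => f i x) n)
            (fun x => sum_f_R0 (fun i => h i x) n).
Proof.
elim: n => [|n IH] H /=; first by apply: H.
apply: (dominated_plus (fun x => sum_f_R0 (fun i => f i x) n)); last by apply: H.
by apply: IH => i Hi; apply: H; lia.
Qed.

(* Induction on the order [r], with
   [(f g)(x+1) - (f g)(x) = f(x+1) (g(x+1) - g(x)) + (f(x+1) - f(x)) g(x)]. *)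
Lemma dominated_mult f g F G :
  dominated f F -> dominated g G ->
  dominated (fun x => f x * g x) (fun x => F x * G x).
Proof.
move=> Hf Hg r; elim: r f g F G Hf Hg => [|r IH] f g F G Hf Hg x.
  rewrite /= Rabs_mult; apply: Rmult_le_compat; try exact: Rabs_pos.
    exact: (Hf 0%nat).
  exact: (Hg 0%nat).
have shift u U : dominated u U -> dominated (fun x => u (S x)) (fun x => U (S x)).
  by move=> H s y; rewrite !diff_shift.
have delta u U : dominated u U ->
    dominated (fun x => u (S x) - u x) (fun x => U (S x) - U x).
  by move=> H s y; apply: (H (S s)).
have E u v : forall y, u (S y) * v (S y) - u y * v y
    = u (S y) * (v (S y) - v y) + (u (S y) - u y) * v y by move=> y; ring.
rewrite !diff_delta (diff_ext _ _ _ _ (E f g)) (diff_ext _ _ _ _ (E F G)) !diff_plus.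
apply: Rle_trans (Rabs_triang _ _) _; apply: Rplus_le_compat.
  by apply: (IH (fun x => f (S x)) (fun x => g (S x) - g x)); [apply: shift|apply: delta].
by apply: (IH (fun x => f (S x) - f x)); [apply: delta|].
Qed.

Lemma dominated_pow f F n :
  dominated f F -> dominated (fun x => f x ^ n) (fun x => F x ^ n).
Proof.
move=> H; elim: n => [|n IH] /=.
  by apply: dominated_const; rewrite Rabs_R1; apply: Rle_refl.
exact: (dominated_mult f).
Qed.

(** * Polynomial degree through vanishing differences *)

Definition deg_le (d : nat) (f : nat -> R) : Prop :=
  forall x, diff (S d) f x = 0.

Lemma deg_le_mono d e f : deg_le d f -> (d <= e)%nat -> deg_le e f.
Proof. by move=> H He; apply: (diff_0_of_le (S e)) H _; lia. Qed.

(** Induction on d + e: the discrete product rule splits the difference of [f g] into two products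
    of total degree one less. *)
Lemma deg_le_mult d e f g :
  deg_le d f -> deg_le e g -> deg_le (d + e) (fun x => f x * g x).
Proof.
have E u v : forall y, u (S y) * v (S y) - u y * v y
    = u (S y) * (v (S y) - v y) + (u (S y) - u y) * v y by move=> y; ring.
have [s Hs] : exists s, s = (d + e)%nat by exists (d + e)%nat.
elim: s d e f g Hs => [|s IH] d e f g Hs Hf Hg x;
  rewrite -Hs diff_delta (diff_ext _ _ _ _ (E f g)) diff_plus.
  have [Hd He] : d = 0%nat /\ e = 0%nat by lia.
  subst; have /= Hf0 := Hf x; have /= Hg0 := Hg x.
  by rewrite /= Hf0 Hg0; ring.
have shiftf : deg_le d (fun x => f (S x)) by move=> y; rewrite diff_shift.
(* Covers a factor of degree 0: its difference is identically zero, and there is no smaller degree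
   for the induction hypothesis. *)
have zero u v : (forall y, u y = 0 \/ v y = 0) -> diff (S s) (fun y => u y * v y) x = 0.
  move=> H; rewrite (diff_ext _ _ (fun _ => 0)) ?diff_const // => y.
  by case: (H y) => ->; ring.
have -> : diff (S s) (fun y => f (S y) * (g (S y) - g y)) x = 0.
  case: e Hs Hg => [|e] Hs Hg.
    by apply: (zero (fun y => f (S y)) (fun y => g (S y) - g y)) => y; right; apply: Hg.
  rewrite (_ : s = d + e)%nat; last lia.
  by apply: (IH d e (fun x => f (S x)) (fun x => g (S x) - g x)) => //; lia.
case: d Hs Hf shiftf => [|d] Hs Hf _.
  rewrite (zero (fun y => f (S y) - f y) g) ?Rplus_0_l // => y.
  by left; apply: Hf.
rewrite Rplus_0_l (_ : s = d + e)%nat; last lia.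
by apply: (IH d e (fun x => f (S x) - f x) g) => //; lia.
Qed.

Lemma deg_le_INR_pow n : deg_le n (fun x => INR x ^ n).
Proof.
elim: n => [|n IH]; first exact: diff_const.
apply: (deg_le_mult 1 n INR) => // x.
rewrite diff_delta (diff_ext _ _ (fun _ => 1)) ?diff_const // => y.
by rewrite S_INR; ring.
Qed.

Lemma deg_le_sum d (f : nat -> nat -> R) n :
  (forall i, (i <= n)%nat -> deg_le d (f i)) ->
  deg_le d (fun x => sum_f_R0 (fun i => f i x) n).
Proof.
by move=> H x; rewrite diff_sum; apply: sum_eq_R0 => i Hi; apply: H.
Qed.

(* Coefficients of [(1 - x t)^(- w x)]; they majorize those of
   [(1 - x t)^(w/t) e^(x w)] because [w x^(i+2) (i+1)/(i+2) <= w x^(i+2)]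
   in the logarithmic derivatives. *)
Fixpoint neg_binom_coef (w x : R) (m : nat) : R :=
  match m with
  | O => 1
  | S p => neg_binom_coef w x p * (x * (w * x + INR p) / INR (S p))
  end.

Lemma neg_binom_coef_S w x m :
  neg_binom_coef w x (S m) = neg_binom_coef w x m * (x * (w * x + INR m) / INR (S m)).
Proof. by []. Qed.

(** Coefficient form of F' = (w x^2 / (1 - x t)) F for F = (1 - x t)^(-w x), in the same convolution
    shape as [be_coef_S]. *)
Lemma neg_binom_coef_rec w x m :
  INR (S m) * neg_binom_coef w x (S m)
  = sum_f_R0 (fun j => w * x ^ (j + 2) * neg_binom_coef w x (m - j)) m.
Proof.
have step p : INR (S p) * neg_binom_coef w x (S p)
    = x * (w * x + INR p) * neg_binom_coef w x p.
  by rewrite neg_binom_coef_S; field; apply: not_0_INR.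
elim: m => [|m IH]; rewrite step; first by rewrite /=; ring.
rewrite decomp_sum; last lia.
rewrite /Nat.pred (sum_eq _ (fun j => w * x ^ (j + 2) * neg_binom_coef w x (m - j) * x)).
  by rewrite -scal_sum -IH /=; ring.
by move=> j _; rewrite Nat.sub_succ /=; ring.
Qed.

Lemma be_coef_S m x w :
  be_coef (S m) x w =
  / INR (S m) * sum_f_R0 (fun j => be_dlog x w j * be_coef (m - j) x w) m.
Proof.
have := be_coef_rec x w m; rewrite /PS_derive /PS_mult => <-.
by field; apply: not_0_INR.
Qed.

(** Strong induction: both families obey convolution recursions of the same shape, whose
    coefficients are dominated term by term, and domination survives sums and products. *)
Lemma be_coef_dominated w m : 0 <= w ->
  dominated (fun x => be_coef m (INR x) w) (fun x => neg_binom_coef w (INR x) m).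
Proof.
move=> w0; elim/(well_founded_induction Wf_nat.lt_wf): m => -[|m] IH.
  by apply: dominated_const; rewrite Rabs_R1; apply: Rle_refl.
have S0 : INR (S m) <> 0 by apply: not_0_INR.
have Si : 0 < / INR (S m) by apply/Rinv_0_lt_compat/lt_0_INR; lia.
apply: (dominated_ext
  (fun x => / INR (S m) * sum_f_R0 (fun j => be_dlog (INR x) w j * be_coef (m - j) (INR x) w) m)
  _ (fun x => / INR (S m)
     * sum_f_R0 (fun j => w * INR x ^ (j + 2) * neg_binom_coef w (INR x) (m - j)) m)).
- by move=> x; rewrite be_coef_S.
- by move=> x; rewrite -neg_binom_coef_rec; field.
apply: (dominated_mult (fun _ => _)).
  by apply: dominated_const; rewrite Rabs_pos_eq; lra.
apply: (dominated_sum (fun j x => be_dlog (INR x) w j * be_coef (m - j) (INR x) w)) => j Hj.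
apply: (dominated_mult (fun x => be_dlog (INR x) w j)); last by apply: IH; lia.
have q0 : 0 < INR (j + 2) by apply: lt_0_INR; lia.
have q1 : INR (j + 1) / INR (j + 2) <= 1.
  apply/Rle_div_l => //; rewrite Rmult_1_l; apply: le_INR; lia.
have q2 : 0 <= INR (j + 1) / INR (j + 2) by apply: Rdiv_le_0_compat => //; apply: pos_INR.
apply: (dominated_ext
  (fun x => (- w * (INR (j + 1) / INR (j + 2))) * INR x ^ (j + 2)) _
  (fun x => w * INR x ^ (j + 2))) => //.
- by move=> x; rewrite /be_dlog; ring.
apply: (dominated_mult (fun _ => _)).
  apply: dominated_const; rewrite Rabs_mult Rabs_Ropp !Rabs_pos_eq //; nra.
by apply: dominated_pow; apply: dominated_INR.
Qed.

(** [be_dlog x w j] has degree j + 2 in x, and j + 2 + 2(m - j) <= 2(m + 1). *)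
Lemma be_coef_deg_le w m : deg_le (2 * m) (fun x => be_coef m (INR x) w).
Proof.
elim/(well_founded_induction Wf_nat.lt_wf): m => -[|m] IH.
  exact: diff_const.
move=> x; rewrite (diff_ext _ _ _ _ (fun y => be_coef_S m (INR y) w)) diff_scal.
rewrite -[X in _ * X]/(diff (S (2 * S m)) _ x).
rewrite [X in _ * X](_ : _ = 0) ?Rmult_0_r //.
apply: (deg_le_sum (2 * S m)
  (fun j x => be_dlog (INR x) w j * be_coef (m - j) (INR x) w)) => j Hj.
apply: (deg_le_mono (j + 2 + 2 * (m - j))); last lia.
apply: (deg_le_mult (j + 2) _ (fun x => be_dlog (INR x) w j)); last by apply: IH; lia.
move=> y; rewrite (diff_ext _ _
  (fun x => (- w * (INR (j + 1) / INR (j + 2))) * INR x ^ (j + 2))).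
  by rewrite diff_scal deg_le_INR_pow Rmult_0_r.
by move=> z; rewrite /be_dlog; ring.
Qed.

(** * Convergence of the expansion up to its singularity *)

Lemma CV_radius_le_of_le (a b : nat -> R) :
  (forall n, Rabs (a n) <= b n) -> Rbar_le (CV_radius b) (CV_radius a).
Proof.
move=> H; apply: (proj2 (CV_radius_bounded b)) => r [M HM].
apply: (proj1 (CV_radius_bounded a)); exists M => n.
apply: Rle_trans (HM n); rewrite !Rabs_mult.
apply: Rmult_le_compat_r; first exact: Rabs_pos.
by apply: Rle_trans (H n) (Rle_abs _).
Qed.

Lemma neg_binom_coef_ge0 w x m : 0 <= w -> 0 <= x -> 0 <= neg_binom_coef w x m.
Proof.
move=> w0 x0; elim: m => [|m IH]; rewrite ?neg_binom_coef_S; first by rewrite /=; lra.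
apply: Rmult_le_pos => //; apply: Rdiv_le_0_compat; last by apply: lt_0_INR; lia.
by apply: Rmult_le_pos => //; have := pos_INR m; have := Rmult_le_pos _ _ w0 x0; lra.
Qed.

Lemma neg_binom_coef_le w x y m : 0 <= w -> 0 <= x <= y ->
  neg_binom_coef w x m <= neg_binom_coef w y m.
Proof.
move=> w0 [x0 xy]; elim: m => [|m IH]; rewrite ?neg_binom_coef_S; first by rewrite /=; lra.
have m0 := pos_INR m; have wx := Rmult_le_pos _ _ w0 x0.
have wxy : w * x <= w * y by apply: Rmult_le_compat_l.
apply: Rmult_le_compat => //; first exact: neg_binom_coef_ge0.
  apply: Rdiv_le_0_compat; last by apply: lt_0_INR; lia.
  by apply: Rmult_le_pos; lra.
apply: Rmult_le_compat_r; first by apply/Rlt_le/Rinv_0_lt_compat/lt_0_INR; lia.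
by apply: Rmult_le_compat; lra.
Qed.

(** Ratio test: consecutive coefficients have ratio x(wx + m)/(m + 1), which tends to x. Positivity
    of [w] and [x] keeps all coefficients nonzero. *)
Lemma CV_radius_neg_binom_coef w x : 0 < w -> 0 < x ->
  CV_radius (neg_binom_coef w x) = Finite (/ x).
Proof.
move=> w0 x0; have wx := Rmult_lt_0_compat _ _ w0 x0.
have S0 m : 0 < INR (S m) by apply: lt_0_INR; lia.
have b0 m : neg_binom_coef w x m <> 0.
  apply: Rgt_not_eq; elim: m => [|m IH]; rewrite ?neg_binom_coef_S; first by rewrite /=; lra.
  apply: Rmult_lt_0_compat => //; apply: Rdiv_lt_0_compat; last exact: (S0 m).
  by apply: Rmult_lt_0_compat => //; have := pos_INR m; lra.
apply: CV_radius_finite_DAlembert => //.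
apply: (is_lim_seq_ext (fun m => x + x * (w * x - 1) * / INR (S m))).
  move=> m; have q := S0 m.
  rewrite neg_binom_coef_S (_ : _ / _ = x * (w * x + INR m) / INR (S m));
    last by field; split; [lra|exact: b0].
  rewrite Rabs_pos_eq; first by rewrite S_INR in q *; field; lra.
  apply: Rdiv_le_0_compat => //.
  by apply: Rmult_le_pos; have := pos_INR m; lra.
rewrite (_ : Finite x = Finite (x + x * (w * x - 1) * 0)); last by congr Finite; ring.
apply: is_lim_seq_plus'; first exact: is_lim_seq_const.
apply: is_lim_seq_mult'; first exact: is_lim_seq_const.
apply/(is_lim_seq_incr_1 (fun m => / INR m)).
exact: (is_lim_seq_inv _ p_infty is_lim_seq_INR).
Qed.

(* The radius given by [be_coef_expansion] can be smaller than [t = 1/k]; the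
   majorant [neg_binom_coef] reaches the singularity. *)
Lemma be_coef_is_pseries (j : nat) w X t :
  0 < w -> INR j <= X -> 0 < X -> t <> 0 -> Rabs t < / X ->
  is_pseries (fun m => be_coef m (INR j) w) t
    (Rpower (1 - INR j * t) (w / t) * exp (INR j * w)).
Proof.
set x := INR j => w0 xX X0 t0 Ht.
have x0 : 0 <= x by exact: pos_INR.
have HX : Rabs x <= X by rewrite Rabs_pos_eq.
set c := fun m => be_coef m x w; set d := be_dlog x w; set g := PS_Int d.
(* The majorant is taken at [X] instead of [x], since [x] may be 0 and the radius computation needs
   a positive argument. *)
have Rc s : Rabs s < / X -> Rbar_lt (Rabs s) (CV_radius c).
  move=> Hs; apply: Rbar_lt_le_trans (_ : Rbar_le (/ X) _) => //.
  rewrite -(CV_radius_neg_binom_coef w) //; apply: CV_radius_le_of_le => m.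
  apply: Rle_trans (be_coef_dominated w m (Rlt_le _ _ w0) 0%nat j) _.
  by apply: neg_binom_coef_le; [lra|split].
have Rd s : Rabs s < / X -> Rbar_lt (Rabs s) (CV_radius d).
  move=> Hs; apply: Rbar_lt_le_trans (_ : Rbar_le (/ X) _) => //.
  apply: (CV_radius_ge_of_bound _ (Rabs w * X ^ 2) X) => // n.
  by apply: Rle_trans (be_dlog_bound _ _ _ _ HX) _; rewrite pow_add; lra.
have DF s : Rabs s < / X -> is_derive (PSeries c) s (PSeries d s * PSeries c s).
  move=> Hs; rewrite -PSeries_mult; [|exact: Rd|exact: Rc].
  by rewrite -(PSeries_ext _ _ _ (be_coef_rec x w)); apply/is_derive_PSeries/Rc.
have DG s : Rabs s < / X -> is_derive (PSeries g) s (PSeries d s).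
  move=> Hs; rewrite -(PSeries_ext (PS_derive g)).
    by apply: is_derive_PSeries; rewrite CV_radius_Int; apply: Rd.
  by move=> n; rewrite /g /PS_derive /PS_Int; field; exact: not_0_INR.
(* [PSeries c] and the exponential of [PSeries g] solve the same linear equation, so their quotient
   is constant. *)
pose h s := PSeries c s * exp (- PSeries g s).
have h0 s : Rabs s < / X -> h s = 1.
  move=> Hs; rewrite (const_of_derive_0 h (/ X)) //.
    by rewrite /h !PSeries_0 /c /g /be_coef /= Ropp_0 exp_0; ring.
  move=> u Hu; have D1 := DF u Hu; have D2 := DG u Hu.
  rewrite /h; auto_derive; first by split; [eexists; exact: D1|split=> //; eexists; exact: D2].
  by rewrite (is_derive_unique _ _ _ D1) (is_derive_unique _ _ _ D2); ring.
(* [g] is the series of -w/t times -ln(1 - x t) with the linear term x t removed; that term accounts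
   for the summand [x * w]. *)
have Gt : PSeries g t = w / t * ln (1 - x * t) + x * w.
  set p := PS_Int (fun i => x ^ S i).
  have Lp : PSeries p t = - ln (1 - x * t) by apply: (PSeries_log x X).
  have Rp : Rbar_lt (Rabs t) (CV_radius p).
    rewrite CV_radius_Int.
    apply: Rbar_lt_le_trans (_ : Rbar_le (/ X) _) => //.
    apply: (CV_radius_ge_of_bound _ X X) => // n.
    rewrite -RPow_abs; apply: (pow_incr _ _ (S n)); split=> //; exact: Rabs_pos.
  have Ep1 := PSeries_decr_1 p t (CV_radius_inside _ _ Rp).
  have Ep2 : PSeries (PS_decr_1 p) t =
      PS_decr_1 p 0%nat + t * PSeries (PS_decr_1 (PS_decr_1 p)) t.
    by apply/PSeries_decr_1/CV_radius_inside; rewrite CV_radius_decr_1.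
  have Eg : PSeries g t = g 0%nat + t * PSeries (PS_decr_1 g) t.
    by apply/PSeries_decr_1/CV_radius_inside; rewrite CV_radius_Int; apply: Rd.
  have E : PSeries (PS_decr_1 g) t = - w * PSeries (PS_decr_1 (PS_decr_1 p)) t.
    rewrite -PSeries_scal; apply: PSeries_ext => n.
    have -> u : PS_scal (- w) u n = - w * u n by [].
    rewrite /PS_decr_1 /p /g /PS_Int /d /be_dlog Nat.add_1_r (_ : (n + 2 = S (S n))%nat); last lia.
    by field; split; apply: not_0_INR.
  have p1 : PS_decr_1 p 0%nat = x by rewrite /PS_decr_1 /p /=; field.
  move: Ep1; rewrite Lp Eg E {1}/p /g /= Ep2 p1 => Ep1.
  rewrite (_ : ln (1 - x * t) = - (0 + t * (x + t * PSeries (PS_decr_1 (PS_decr_1 p)) t)));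
    last lra.
  by field.
have -> : Rpower (1 - x * t) (w / t) * exp (x * w) = PSeries c t.
  rewrite /Rpower -exp_plus -Gt.
  have := h0 t Ht; rewrite /h exp_Ropp => H.
  have := exp_pos (PSeries g t) => He.
  rewrite -[LHS]Rmult_1_r -H; field; lra.
by apply/PSeries_correct/CV_radius_inside/Rc.
Qed.

(** * Bounding the remainder *)

Lemma binom_ge0 n r : 0 <= Binomial.C n r.
Proof.
rewrite /Binomial.C; apply: Rdiv_le_0_compat; first exact: pos_INR.
by apply: Rmult_lt_0_compat; apply: INR_fact_lt_0.
Qed.

Lemma binom_S n r : (r < n)%nat ->
  Binomial.C n (S r) = Binomial.C n r * ((INR n - INR r) / INR (S r)).
Proof.
move=> Hr; rewrite /Binomial.C -minus_INR; last lia.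
have -> : (n - r = S (n - S r))%nat by lia.
rewrite !fact_simpl !mult_INR; field.
by repeat split; try apply: INR_fact_neq_0; apply: not_0_INR.
Qed.

(** Compare ratios of consecutive terms: (k - r)s <= ks <= n - r0 <= n - r. *)
Lemma binom_mul_pow_le k n s r0 :
  0 <= s -> (r0 <= k)%nat -> (r0 <= n)%nat -> INR k * s <= INR n - INR r0 ->
  forall r, (r <= r0)%nat -> Binomial.C k r * s ^ r <= Binomial.C n r.
Proof.
move=> s0 Hk Hn H; elim=> [|r IH] Hr; first by rewrite !binom_n_0 /=; lra.
have r1 : INR r <= INR r0 by apply: le_INR; lia.
have rk : INR r0 <= INR k by apply: le_INR.
have r00 := pos_INR r; have S0 : 0 < INR (S r) by apply: lt_0_INR; lia.
rewrite !binom_S; [|lia..].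
rewrite (_ : _ * s ^ S r = (Binomial.C k r * s ^ r) * ((INR k - INR r) * s / INR (S r)));
  last by rewrite -tech_pow_Rmult; field; lra.
apply: Rmult_le_compat.
- by apply: Rmult_le_pos; [apply: binom_ge0|apply: pow_le].
- by apply: Rdiv_le_0_compat => //; apply: Rmult_le_pos; lra.
- by apply: IH; lia.
apply: Rmult_le_compat_r; first by apply/Rlt_le/Rinv_0_lt_compat.
nra.
Qed.

Lemma is_lim_seq_sum_f_R0 (u : nat -> nat -> R) (l : nat -> R) n :
  (forall i, (i <= n)%nat -> is_lim_seq (fun m => u m i) (l i)) ->
  is_lim_seq (fun m => sum_f_R0 (u m) n) (sum_f_R0 l n).
Proof.
elim: n => [|n IH] H /=; first by apply: H.
by apply: is_lim_seq_plus'; [apply: IH => i Hi|]; apply: H; lia.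
Qed.

Lemma sum_f_R0_le_more (u : nat -> R) m n :
  (m <= n)%nat -> (forall i, (i <= n)%nat -> 0 <= u i) -> sum_f_R0 u m <= sum_f_R0 u n.
Proof.
elim: n => [|n IH] Hm H; first by have -> : m = 0%nat by [lia]; apply: Rle_refl.
case: (Nat.eq_dec m (S n)) => [->|?]; first exact: Rle_refl.
rewrite tech5; have := H (S n) (le_n _); have := IH ltac:(lia) (fun i Hi => H i ltac:(lia)); lra.
Qed.

(** For each m, Newton's expansion sums the majorant's differences to [h m n], and truncation at
    [r0] only discards nonnegative terms. Then let m tend to infinity; only the values of [f] up to
    [r0] enter. *)
Lemma sum_binom_diff_le (f : nat -> R) (u h : nat -> nat -> R) r0 n B :
  (r0 <= n)%nat ->
  (forall m, dominated (u m) (h m)) ->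
  (forall j, (j <= r0)%nat -> is_lim_seq (fun m => u m j) (f j)) ->
  (forall m, h m n <= B) ->
  sum_f_R0 (fun r => Binomial.C n r * Rabs (diff r f 0)) r0 <= B.
Proof.
move=> Hr Hd Hl HB.
apply: (is_lim_seq_le
  (fun m => sum_f_R0 (fun r => Binomial.C n r * Rabs (diff r (u m) 0)) r0)
  (fun _ => B) (Finite _) (Finite B)).
- move=> m; apply: Rle_trans (HB m); rewrite (newton_expansion n (h m)).
  apply: Rle_trans (sum_f_R0_le_more _ r0 n Hr _).
    apply: sum_Rle => r _; apply: Rmult_le_compat_l; first exact: binom_ge0.
    exact: Hd.
  move=> r _; apply: Rmult_le_pos; first exact: binom_ge0.
  exact: Rle_trans (Rabs_pos _) (Hd m r 0%nat).
- apply: is_lim_seq_sum_f_R0 => r Hr0.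
  apply: is_lim_seq_mult'; first exact: is_lim_seq_const.
  apply: (is_lim_seq_abs _ (Finite _)); apply: is_lim_seq_diff => y Hy.
  by apply: Hl; lia.
- exact: is_lim_seq_const.
Qed.

Lemma exp_nondecreasing a b : a <= b -> exp a <= exp b.
Proof. by case=> [H|->]; [apply/Rlt_le/exp_increasing|apply: Rle_refl]. Qed.

(** Weight the terms by e^(r - r0) >= 1 and complete the sum: (1 + 2es)^k <= e^(2eks) <= e^(6ks). *)
Lemma sum_binom_tail_le k s r0 : 0 <= s -> (r0 < k)%nat ->
  sum_f_R0 (fun i => Binomial.C k (S r0 + i) * s ^ (S r0 + i) * 2 ^ (S r0 + i)) (k - S r0)
  <= exp (6 * (INR k * s) - INR r0).
Proof.
move=> s0 Hr.
(* The factor [1 ^ (k - r)] gives the terms the shape required by [binomial]. *)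
pose T r := Binomial.C k r * (2 * s * exp 1) ^ r * 1 ^ (k - r).
have e0 := exp_pos 1; have e3 := exp_le_3.
have y0 : 0 <= 2 * s * exp 1 by apply: Rmult_le_pos; lra.
have T0 r : 0 <= T r.
  by rewrite /T pow1 Rmult_1_r; apply: Rmult_le_pos; [apply: binom_ge0|apply: pow_le].
apply: (Rle_trans _ (exp (- INR r0) * sum_f_R0 T k)).
  rewrite (tech2 T r0 k) //.
  apply: (Rle_trans _ (exp (- INR r0) * sum_f_R0 (fun i => T (S r0 + i)%nat) (k - S r0))).
    rewrite scal_sum; apply: sum_Rle => i Hi.
    rewrite /T pow1 !Rpow_mult_distr Rmult_1_r.
    set r := (S r0 + i)%nat.
    have E : 1 <= exp 1 ^ r * exp (- INR r0).
      rewrite -(Rpower_pow r) // /Rpower ln_exp Rmult_1_r -exp_plus.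
      rewrite -exp_0; apply: exp_nondecreasing.
      have : INR r0 <= INR r by apply: le_INR; rewrite /r; lia.
      lra.
    have P0 : 0 <= Binomial.C k r * (2 ^ r * s ^ r).
      apply: Rmult_le_pos; first exact: binom_ge0.
      by apply: Rmult_le_pos; apply: pow_le; lra.
    have := Rmult_le_compat_l _ _ _ P0 E; lra.
  apply: Rmult_le_compat_l; first exact/Rlt_le/exp_pos.
  have := cond_pos_sum T r0 T0; lra.
rewrite -binomial Rplus_comm.
apply: (Rle_trans _ (exp (- INR r0) * exp (2 * s * exp 1) ^ k)).
  apply: Rmult_le_compat_l; first exact/Rlt_le/exp_pos.
  by apply: pow_incr; split; [lra|apply: exp_ineq1_le].
rewrite -(Rpower_pow k) ?/Rpower ?ln_exp; last exact: exp_pos.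
rewrite -exp_plus; apply: exp_nondecreasing.
have k0 := pos_INR k; have : INR k * s * exp 1 <= INR k * s * 3.
  by apply: Rmult_le_compat_l => //; apply: Rmult_le_pos.
lra.
Qed.

Definition be_partial_sum (N : nat) (x w t : R) : R :=
  sum_f_R0 (fun m => be_coef m x w * t ^ m) N.

(** The Newton sum is cut at [r0]: [B] bounds the low orders through the majorant at [m], the
    exponential bounds the high orders. The condition m < k puts t = 1/k inside the disc of radius
    1/m. *)
Lemma Snk_sub_be_partial_sum_le n k N r0 m B :
  let w := INR n / INR k in let q := exp (- w) in let s := q / (1 - q) in
  (0 < n)%nat -> (0 < m < k)%nat -> (r0 <= m)%nat -> (2 * N <= r0)%nat ->
  INR k * s <= INR m - INR r0 ->
  (forall M, sum_f_R0 (fun i =>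
     neg_binom_coef w (INR m) (S N + i) * (/ INR k) ^ (S N + i)) M <= B) ->
  Rabs (Snk n k - sum_f_R0 (fun j => (-1) ^ j * Binomial.C k j * q ^ j *
                     be_partial_sum N (INR j) w (/ INR k)) k)
  <= (1 - q) ^ k * (B + exp (6 * (INR k * s) - INR r0)).
Proof.
move=> w q s Hn Hm Hr0 HN Hs HB.
have k0 : 0 < INR k by apply: lt_0_INR; lia.
have w0 : 0 < w by apply: Rdiv_lt_0_compat => //; apply: lt_0_INR.
have q0 : 0 < q by exact: exp_pos.
have q1 : q < 1 by rewrite -exp_0; apply: exp_increasing; lra.
have s0 : 0 <= s by apply/Rlt_le/Rdiv_lt_0_compat; lra.
pose F j := (1 - INR j / INR k) ^ n * exp (INR j * w).
pose P j := be_partial_sum N (INR j) w (/ INR k).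
pose f j := F j - P j.
have E : Snk n k - sum_f_R0 (fun j => (-1) ^ j * Binomial.C k j * q ^ j * P j) k
   = sum_f_R0 (fun j => Binomial.C k j * ((- q) ^ j * f j)) k.
  rewrite Snk_alternating_sum; last lia.
  rewrite -minus_sum; apply: sum_eq => j Hj.
  (* This identity inserts e^(jw) into the alternating sum, compensated by [q ^ j]. *)
  have qj : q ^ j * exp (INR j * w) = 1.
    rewrite -Rpower_pow // /Rpower /q ln_exp -exp_plus -exp_0; congr exp; ring.
  rewrite /f /F (_ : - q = -1 * q) ?Rpow_mult_distr; last ring.
  rewrite -[in LHS](Rmult_1_r ((1 - INR j / INR k) ^ n)) -qj; ring.
rewrite E binomial_sum_diff.
apply: (Rle_trans _ ((1 - q) ^ k *
  sum_f_R0 (fun r => Binomial.C k r * s ^ r * Rabs (diff r f 0)) k)).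
  apply: Rle_trans (Rsum_abs _ _) _; rewrite scal_sum; apply: sum_Rle => r Hr.
  rewrite Rabs_mult (Rabs_mult (_ * _)) (Rabs_mult (_ ^ _)).
  rewrite (Rabs_pos_eq (Binomial.C k r)); last exact: binom_ge0.
  rewrite -RPow_abs Rabs_Ropp (Rabs_pos_eq q); last lra.
  rewrite (Rabs_pos_eq ((1 + - q) ^ _)); last by apply: pow_le; lra.
  (* Since s = q/(1 - q), q^r (1 - q)^(k-r) equals (1 - q)^k s^r. *)
  right; rewrite /s Rpow_mult_distr pow_inv.
  rewrite (_ : (1 - q) ^ k = (1 - q) ^ (k - r) * (1 - q) ^ r).
    by rewrite /Rminus; field; apply: pow_nonzero; lra.
  by rewrite -pow_add; congr pow; lia.
apply: Rmult_le_compat_l; first by apply: pow_le; lra.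
rewrite (tech2 _ r0 k); last lia.
apply: Rplus_le_compat.
  apply: (Rle_trans _ (sum_f_R0 (fun r => Binomial.C m r * Rabs (diff r f 0)) r0)).
    apply: sum_Rle => r Hr; apply: Rmult_le_compat_r; first exact: Rabs_pos.
    by apply: (binom_mul_pow_le k m s r0) => //; lia.
  apply: (sum_binom_diff_le f
    (fun M x => sum_f_R0 (fun i => be_coef (S N + i) (INR x) w * (/ INR k) ^ (S N + i)) M)
    (fun M x => sum_f_R0 (fun i => neg_binom_coef w (INR x) (S N + i) * (/ INR k) ^ (S N + i)) M)) => //.
    move=> M; apply: (dominated_sum (fun i x => be_coef (S N + i) (INR x) w * (/ INR k) ^ (S N + i))
      (fun i x => neg_binom_coef w (INR x) (S N + i) * (/ INR k) ^ (S N + i))) => i _.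
    apply: (dominated_mult (fun x => be_coef (S N + i) (INR x) w)).
      by apply: be_coef_dominated; lra.
    apply: dominated_const; rewrite Rabs_pos_eq; first exact: Rle_refl.
    by apply/pow_le/Rlt_le/Rinv_0_lt_compat.
  move=> j Hj.
  have jm : INR j <= INR m by apply: le_INR; lia.
  have m0 : 0 < INR m by apply: lt_0_INR; lia.
  have mk : INR m < INR k by apply: lt_INR; lia.
  have jk : INR j / INR k < 1 by apply/Rlt_div_l => //; lra.
  have ik : 0 < / INR k by apply: Rinv_0_lt_compat.
  have /is_pseries_R H := be_coef_is_pseries j w (INR m) (/ INR k) w0 jm m0 ltac:(lra)
    ltac:(rewrite Rabs_pos_eq; [apply: Rinv_lt_contravar; nra|lra]).
  (* At t = 1/k the exponent w/t is exactly n, so the real power is an ordinary one. *)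
  have EF : Rpower (1 - INR j * / INR k) (w / / INR k) * exp (INR j * w) = F j.
    rewrite /F (_ : w / / INR k = INR n); last by rewrite /w; field; lra.
    rewrite Rpower_pow //; rewrite /Rdiv in jk; lra.
  rewrite EF in H.
  have {}H : is_series (fun i => be_coef (S N + i) (INR j) w * (/ INR k) ^ (S N + i)) (f j).
    apply: (is_series_incr_n (fun i => be_coef i (INR j) w * (/ INR k) ^ i)); first lia.
    rewrite sum_n_Reals /plus /= /f /P /be_partial_sum.
    by rewrite (_ : F j - _ + _ = F j) //; ring.
  apply: (is_lim_seq_ext (sum_n (fun i => be_coef (S N + i) (INR j) w * (/ INR k) ^ (S N + i)))).
    by move=> M; rewrite sum_n_Reals.
  exact: H.
apply: Rle_trans (sum_binom_tail_le k s r0 s0 ltac:(lia)).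
apply: sum_Rle => i Hi; set r := (S r0 + i)%nat.
apply: Rmult_le_compat_l.
  by apply: Rmult_le_pos; [apply: binom_ge0|apply: pow_le].
have -> : diff r f 0 = diff r F 0.
  rewrite diff_minus (_ : diff r P 0 = 0); first ring.
  apply: (diff_0_of_le r (S (2 * N))); last by rewrite /r; lia.
  apply: (deg_le_sum _ (fun i x => be_coef i (INR x) w * (/ INR k) ^ i)) => l Hl.
  apply: (deg_le_mono (2 * l + 0)); last lia.
  apply: (deg_le_mult _ _ (fun x => be_coef l (INR x) w)); first exact: be_coef_deg_le.
  exact: diff_const.
rewrite -[2 ^ r]Rmult_1_r; apply: Rabs_diff_le => y Hy.
have yk : INR y / INR k <= 1.
  apply/Rle_div_l => //; rewrite Rmult_1_l; apply: le_INR; rewrite /r in Hy; lia.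
rewrite Rabs_pos_eq; last first.
  by apply: Rmult_le_pos; [apply: pow_le; lra|apply/Rlt_le/exp_pos].
(* From 1 - y/k <= e^(-y/k), [F y] is at most e^(-ny/k) e^(yw) = 1. *)
apply: (Rle_trans _ (exp (- (INR y / INR k)) ^ n * exp (INR y * w))).
  apply: Rmult_le_compat_r; first exact/Rlt_le/exp_pos.
  by apply: pow_incr; split; [lra|apply: exp_ineq1_le].
right; rewrite -(Rpower_pow n) ?/Rpower ?ln_exp; last exact: exp_pos.
by rewrite -exp_plus -exp_0; congr exp; rewrite /w; field; lra.
Qed.

(** * Tail of the majorant series *)

Fixpoint ratio_seq (A : R) (i : nat) : R :=
  match i with
  | O => 1
  | S i => ratio_seq A i * (A / INR (S i) + / 2)
  end.

Lemma ratio_seq_S A i : ratio_seq A (S i) = ratio_seq A i * (A / INR (S i) + / 2).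
Proof. by []. Qed.

Lemma ratio_seq_gt0 A i : 0 <= A -> 0 < ratio_seq A i.
Proof.
move=> A0; elim: i => [|i IH]; first by rewrite /=; lra.
rewrite ratio_seq_S; apply: Rmult_lt_0_compat => //.
by have := Rdiv_le_0_compat A (INR (S i)) A0 (lt_0_INR _ (Nat.lt_0_succ i)); lra.
Qed.

(** The consecutive ratios tend to 1/2; the bound depends on [A] alone, which makes the tail
    estimate uniform. *)
Lemma sum_ratio_seq_bounded A : 0 <= A ->
  exists V, forall M, sum_f_R0 (ratio_seq A) M <= V.
Proof.
move=> A0; have v0 i := ratio_seq_gt0 A i A0.
have [V HV] : ex_series (fun i => Rabs (ratio_seq A i)).
  apply: (ex_series_DAlembert _ (/ 2)); [lra|by move=> i; apply/Rgt_not_eq/v0|].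
  apply: (is_lim_seq_ext (fun i => A * / INR (S i) + / 2)).
    move=> i; rewrite ratio_seq_S Rabs_pos_eq.
      by field; split; [exact: not_0_INR|apply/Rgt_not_eq/v0].
    rewrite -ratio_seq_S; apply/Rlt_le/Rdiv_lt_0_compat; exact: v0.
  rewrite (_ : Finite (/ 2) = Finite (A * 0 + / 2)); last by congr Finite; ring.
  apply: is_lim_seq_plus'; last exact: is_lim_seq_const.
  apply: is_lim_seq_mult'; first exact: is_lim_seq_const.
  apply/(is_lim_seq_incr_1 (fun m => / INR m)).
  exact: (is_lim_seq_inv _ p_infty is_lim_seq_INR).
exists V => M; rewrite -sum_n_Reals (sum_n_ext _ (fun i => Rabs (ratio_seq A i))).
  apply: (is_lim_seq_incr_compare (sum_n (fun i => Rabs (ratio_seq A i))) V HV) => i.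
  by rewrite !sum_n_Reals tech5; have := Rabs_pos (ratio_seq A (S i)); lra.
by move=> i; rewrite Rabs_pos_eq //; apply/Rlt_le/v0.
Qed.

(** With a = wx and z = xt, consecutive terms have ratio (a + m)z/(m + 1). It is at most az because
    a >= 1, which controls the first N + 1 steps; afterwards az <= A and z <= 1/2 allow comparison
    with [ratio_seq A]. *)
Lemma neg_binom_tail_le N A : 0 <= A ->
  exists V, forall w x t M, 0 <= x -> 0 <= t -> 1 <= w * x -> x * t <= / 2 ->
    w * x * (x * t) <= A ->
    sum_f_R0 (fun i => neg_binom_coef w x (S N + i) * t ^ (S N + i)) M
    <= V * (w * x * (x * t)) ^ S N.
Proof.
move=> A0; have [V HV] := sum_ratio_seq_bounded A A0.
exists V => w x t M x0 t0 a1 z2 azA.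
set a := w * x in a1 azA *; set z := x * t in z2 azA *.
have z0 : 0 <= z by apply: Rmult_le_pos.
have az0 : 0 <= a * z by apply: Rmult_le_pos; lra.
pose u m := neg_binom_coef w x m * t ^ m.
have uS m : u (S m) = u m * ((a + INR m) * z / INR (S m)).
  rewrite /u neg_binom_coef_S /a /z -tech_pow_Rmult; field; exact: not_0_INR.
have S0 m : 0 < INR (S m) by apply: lt_0_INR; lia.
have r0 m : 0 <= (a + INR m) * z / INR (S m).
  apply: Rdiv_le_0_compat => //; apply: Rmult_le_pos => //; have := pos_INR m; lra.
have u0 m : 0 <= u m.
  elim: m => [|m IH]; first by rewrite /u /=; lra.
  by rewrite uS; apply: Rmult_le_pos.
have u1 m : u m <= (a * z) ^ m.
  elim: m => [|m IH]; first by rewrite /u /=; lra.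
  rewrite uS -tech_pow_Rmult Rmult_comm; apply: Rmult_le_compat => //.
  apply/Rle_div_l => //; rewrite S_INR; have := pos_INR m => m0.
  have : INR m * z * 1 <= INR m * z * a by apply: Rmult_le_compat_l => //; apply: Rmult_le_pos.
  lra.
have u2 i : u (S N + i)%nat <= (a * z) ^ S N * ratio_seq A i.
  elim: i => [|i IH]; first by rewrite Nat.add_0_r Rmult_1_r; apply: u1.
  rewrite Nat.add_succ_r uS ratio_seq_S -Rmult_assoc; apply: Rmult_le_compat => //.
  set m := (S N + i)%nat.
  have im : INR (S i) <= INR (S m) by apply: le_INR; rewrite /m; lia.
  rewrite (_ : _ / _ = a * z / INR (S m) + z * (INR m / INR (S m)));
    last by field; apply/Rgt_not_eq/S0.
  apply: Rplus_le_compat.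
    apply: Rmult_le_compat => //; first by apply/Rlt_le/Rinv_0_lt_compat.
    by apply: Rinv_le_contravar.
  rewrite -[X in _ <= X]Rmult_1_r; apply: Rmult_le_compat => //.
    by apply: Rdiv_le_0_compat => //; apply: pos_INR.
  by apply/Rle_div_l => //; rewrite S_INR; lra.
apply: (Rle_trans _ (sum_f_R0 (fun i => ratio_seq A i * (a * z) ^ S N) M)).
  by apply: sum_Rle => i _; rewrite Rmult_comm; have := u2 i; rewrite /u; lra.
rewrite -scal_sum Rmult_comm; apply: Rmult_le_compat_r; [exact: pow_le|exact: HV].
Qed.

(** * Elementary estimates and the range of n and k *)

(** Raise v <= e^v to the power p + 1 at v = l/(2(p + 1)). *)
Lemma pow_le_exp_half p l : 0 <= l ->
  l ^ S p <= (2 * INR (S p)) ^ S p * exp (l / 2).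
Proof.
move=> l0; have S0 : 0 < INR (S p) by apply: lt_0_INR; lia.
have x0 : 0 <= l / (2 * INR (S p)) by apply: Rdiv_le_0_compat; lra.
have -> : exp (l / 2) = exp (l / (2 * INR (S p))) ^ S p.
  rewrite -Rpower_pow; last exact: exp_pos.
  by rewrite /Rpower ln_exp; congr exp; field; lra.
rewrite -Rpow_mult_distr; apply: pow_incr; split=> //.
have := exp_ineq1_le (l / (2 * INR (S p))) => E.
have : 2 * INR (S p) * (l / (2 * INR (S p))) = l by field; lra.
have := Rmult_le_compat_l (2 * INR (S p)) (l / (2 * INR (S p))) (exp (l / (2 * INR (S p)))).
lra.
Qed.

(** Lets finitely many small pairs be absorbed into the implied constant. *)
Lemma finite_ratio_bound (f g : nat -> nat -> R) n0 :
  exists K, forall n k, (n < n0)%nat -> (k < n0)%nat -> 0 < g n k ->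
    f n k <= K * g n k.
Proof.
have row (u v : nat -> R) m :
    exists K, 0 <= K /\ forall k, (k < m)%nat -> 0 < v k -> u k <= K * v k.
  elim: m => [|m [K [K0 IH]]]; first by exists 0; split; [lra|lia].
  have H1 := Rmax_l K (u m / v m); have H2 := Rmax_r K (u m / v m).
  exists (Rmax K (u m / v m)); split; first lra.
  move=> k Hk v0; case: (Nat.eq_dec k m) => [E|?].
    by rewrite E in v0 *; apply/(Rle_div_l _ _ _ v0).
  apply: Rle_trans (IH k ltac:(lia) v0) _.
  by apply: Rmult_le_compat_r => //; lra.
suff [K [_ H]] : exists K, 0 <= K /\ forall n k, (n < n0)%nat -> (k < n0)%nat -> 0 < g n k ->
    f n k <= K * g n k by exists K.
elim: {1}n0 => [|m [K [K0 IH]]]; first by exists 0; split; [lra|lia].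
have [K' [K'0 H]] := row (f m) (g m) n0.
exists (K + K'); split; first lra.
move=> n k Hn Hk g0; case: (Nat.eq_dec n m) => [E|?].
  by rewrite E in g0 *; have := H k Hk g0; have := Rmult_le_pos _ _ K0 (Rlt_le _ _ g0); lra.
by have := IH n k ltac:(lia) Hk g0; have := Rmult_le_pos _ _ K'0 (Rlt_le _ _ g0); lra.
Qed.

Lemma nat_ceil x : 0 <= x -> exists m : nat, x <= INR m <= x + 1.
Proof.
by move=> x0; have [m Hm] := nfloor_ex x x0; exists (S m); rewrite S_INR; lra.
Qed.

(** The two inequalities chain to k(l + 6) <= 2n <= 2kl, whence l >= 6. The case l = 0 means n = 1,
    where the upper bound on k would give 6k <= 2. *)
Lemma regime_bounds n k :
  (0 < n)%nat -> (0 < k)%nat ->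
  INR n / ln (INR n) <= INR k ->
  INR k <= 2 * INR n / (ln (INR n) + 6) ->
  let l := ln (INR n) in let w := INR n / INR k in
  6 <= l /\ (l + 6) / 2 <= w <= l.
Proof.
move=> Hn Hk H1 H2 l w.
have n1 : 1 <= INR n by rewrite -[1]/(INR 1); apply: le_INR.
have k1 : 1 <= INR k by rewrite -[1]/(INR 1); apply: le_INR.
have l0 : 0 <= l by rewrite /l -ln_1; apply: ln_le; lra.
have {}H2 : INR k * (l + 6) <= 2 * INR n by apply/Rle_div_r => //; rewrite -/l in H2; lra.
have lp : 0 < l.
  case: l0 => // l0.
  have E : INR n = 1 by apply: ln_inv; [lra|lra|rewrite ln_1 -/l].
  by rewrite E -l0 in H2; lra.
have {}H1 : INR n <= INR k * l by apply/Rle_div_l.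
split; first nra.
split.
  by apply: (proj1 (Rle_div_r _ _ (INR k) _)); lra.
by apply: (proj2 (Rle_div_l _ _ (INR k) _)); lra.
Qed.

(* The spare factor [mu] in the odd exponent pays for the powers of [l]. *)
Lemma pow_add_sqr_log_le N : exists W, 0 <= W /\ forall l mu,
  0 <= l -> exp (- (l / 2)) <= mu <= 2 ->
  (mu + l ^ 2 * exp (- (l / 2))) ^ (2 * S N) <= W * mu ^ (2 * N + 1).
Proof.
pose Kp := (2 * INR (4 * S N)) ^ (4 * S N).
have Kp0 : 0 <= Kp by apply: pow_le; have := pos_INR (4 * S N); lra.
have T0 : 0 <= 2 ^ (2 * S N) by apply: pow_le; lra.
exists (2 ^ (2 * S N) * (2 + Kp)); split; first by apply: Rmult_le_pos; lra.
move=> l mu l0; set y := exp (- (l / 2)); move=> [ymu mu2].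
have y0 : 0 < y by exact: exp_pos.
have l2 : 0 <= l ^ 2 * y by apply: Rmult_le_pos; [apply: pow_le|]; lra.
have E2 : (2 * S N = S (2 * N + 1))%nat by lia.
have mp : 0 <= mu ^ (2 * N + 1) by apply: pow_le; lra.
have yp : y ^ (2 * N + 1) <= mu ^ (2 * N + 1) by apply: pow_incr; lra.
have B1 : mu ^ (2 * S N) <= 2 * mu ^ (2 * N + 1).
  by rewrite E2 -tech_pow_Rmult; apply: Rmult_le_compat_r; lra.
(* One of the 2N + 2 factors [y] cancels the e^(l/2) that bounds l^(4N+4); the others are at most
   [mu]. *)
have B2 : (l ^ 2 * y) ^ (2 * S N) <= Kp * mu ^ (2 * N + 1).
  rewrite Rpow_mult_distr -pow_mult (_ : (2 * (2 * S N) = S (4 * N + 3))%nat); last lia.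
  have H := pow_le_exp_half (4 * N + 3) l l0.
  have E4 : (S (4 * N + 3) = 4 * S N)%nat by lia.
  rewrite E4 -/Kp in H *.
  have Ey : exp (l / 2) * y = 1.
    by rewrite /y -exp_plus -exp_0; congr exp; ring.
  apply: (Rle_trans _ (Kp * exp (l / 2) * y ^ (2 * S N))).
    by apply: Rmult_le_compat_r => //; apply: pow_le; lra.
  rewrite E2 -tech_pow_Rmult.
  rewrite (_ : _ * _ = Kp * (exp (l / 2) * y) * y ^ (2 * N + 1)); last ring.
  by rewrite Ey Rmult_1_r; apply: Rmult_le_compat_l.
(* The sum is at most twice its larger summand. *)
case: (Rle_lt_dec (l ^ 2 * y) mu) => H.
  apply: (Rle_trans _ ((2 * mu) ^ (2 * S N))); first by apply: pow_incr; lra.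
  rewrite Rpow_mult_distr Rmult_assoc; apply: Rmult_le_compat_l => //.
  by have := Rmult_le_pos _ _ Kp0 mp; lra.
apply: (Rle_trans _ ((2 * (l ^ 2 * y)) ^ (2 * S N))); first by apply: pow_incr; lra.
rewrite Rpow_mult_distr Rmult_assoc; apply: Rmult_le_compat_l => //; lra.
Qed.

(** * Choice of parameters and conclusion *)

Lemma Snk_remainder_large N : exists K n0, forall n k,
  (0 < n)%nat -> (0 < k)%nat -> n0 <= INR n ->
  INR n / ln (INR n) <= INR k ->
  INR k <= 2 * INR n / (ln (INR n) + 6) ->
  let q := exp (- (INR n / INR k)) in
  Rabs (Snk n k - sum_f_R0 (fun j => (-1) ^ j * Binomial.C k j * q ^ j *
                     be_partial_sum N (INR j) (INR n / INR k) (/ INR k)) k)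
  <= K * ((1 - q) ^ k * (INR k * q * ln (INR n) / sqrt (INR n)) ^ (2 * N + 1)).
Proof.
(* [C] is large enough for m <= C(lambda + l). Below, mu <= 2 and nu <= 16 give C(mu + nu) <= 18C,
   hence the argument of the tail bound. *)
set C := 3 * INR N + 14; have N0 := pos_INR N.
have C14 : 14 <= C by rewrite /C; lra.
have [V HV] := neg_binom_tail_le N ((18 * C) ^ 2) (pow2_ge_0 _).
have [W [W0 HW]] := pow_add_sqr_log_le N.
have V0 : 0 <= Rabs V by exact: Rabs_pos.
(* The threshold gives sqrt n >= 36C, so m/k <= 18C/sqrt n <= 1/2. *)
exists (Rabs V * (C ^ (2 * S N) * W) + 1), ((36 * C) ^ 2).
move=> n k Hn Hk Hn0 H1 H2 q.
have [] := regime_bounds n k Hn Hk H1 H2.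
set l := ln (INR n) in H1 H2 *; set w := INR n / INR k.
move=> l6 [wl lw].
have n0 : 0 < INR n by apply: lt_0_INR.
have k0 : 0 < INR k by apply: lt_0_INR.
set y := exp (l / 2).
have y0 : 0 < y by exact: exp_pos.
have ny : INR n = y * y by rewrite /y -exp_plus -{1}(exp_ln (INR n)) // -/l; congr exp; field.
have sy : sqrt (INR n) = y by rewrite ny sqrt_square; lra.
have yi : exp (- (l / 2)) = / y by rewrite exp_Ropp.
have y36 : 36 * C <= y.
  by rewrite -sy -(sqrt_pow2 (36 * C)); [apply: sqrt_le_1_alt|lra].
set lm := INR k * q.
have q0 : 0 < q by exact: exp_pos.
have lm0 : 0 < lm by apply: Rmult_lt_0_compat.
have nk : INR n <= INR k * l by rewrite Rmult_comm; apply/(Rle_div_l _ _ _ k0).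
have kn : INR k * (l + 6) <= 2 * INR n.
  have := proj2 (Rle_div_r _ _ _ k0) wl; lra.
have qy : q <= / y.
  by rewrite -yi; apply: exp_nondecreasing; rewrite -/w; lra.
have q2 : q <= / 2.
  apply: Rle_trans qy _; apply: Rinv_le_contravar; lra.
set mu := lm * l / sqrt (INR n).
(* w <= l gives q >= 1/n, so lambda l = klq >= nq >= 1. *)
have mu_lo : / y <= mu.
  rewrite /mu sy; apply/(Rle_div_r _ _ _ y0); rewrite Rinv_l; last lra.
  have qn : / INR n <= q.
    by rewrite -[INR n]exp_ln // -exp_Ropp; apply: exp_nondecreasing; rewrite -/l -/w; lra.
  have {}qn : 1 <= INR n * q.
    by rewrite -(Rinv_r (INR n)); [apply: Rmult_le_compat_l|]; lra.
  have := Rmult_le_compat_r q _ _ (Rlt_le _ _ q0) nk; rewrite /lm; lra.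
(* w >= l/2 gives q <= 1/sqrt n, and kl <= 2n. *)
have mu_hi : mu <= 2.
  rewrite /mu sy; apply/(Rle_div_l _ _ _ y0).
  have : lm * l <= INR k * (/ y) * l.
    by apply: Rmult_le_compat_r; [lra|apply: Rmult_le_compat_l; lra].
  have : INR k * l * / y <= 2 * INR n * / y.
    apply: Rmult_le_compat_r; [by apply/Rlt_le/Rinv_0_lt_compat|lra].
  have : 2 * INR n * / y = 2 * y by rewrite ny; field; lra.
  lra.
have nu16 : l ^ 2 * exp (- (l / 2)) <= 16.
  have := pow_le_exp_half 1 l ltac:(lra); rewrite -/y yi => H.
  apply/(Rle_div_l _ _ _ y0); rewrite /= in H *; lra.
set nu := l ^ 2 * exp (- (l / 2)) in nu16.
have nu0 : 0 <= nu by apply: Rmult_le_pos; [apply: pow2_ge_0|apply/Rlt_le/exp_pos].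
have munu : (lm + l) * l = y * (mu + nu).
  by rewrite /mu /nu sy yi; field; lra.
have [L HL] := nat_ceil (2 * lm) ltac:(lra).
have [M HM] := nat_ceil ((INR N + 1) * l) ltac:(apply: Rmult_le_pos; lra).
(* As L >= 2 lambda >= ks, the gap m - r0 = L suffices and 6ks - r0 <= -M <= -(N + 1)l; the summand
   2N ensures r0 >= 2N. *)
pose r0 := (6 * L + (M + 2 * N))%nat; pose m := (7 * L + (M + 2 * N))%nat.
have Er : INR r0 = 6 * INR L + (INR M + 2 * INR N).
  by rewrite /r0 plus_INR mult_INR (plus_INR M) (mult_INR 2) /=; ring.
have Em : INR m = 7 * INR L + (INR M + 2 * INR N).
  by rewrite /m plus_INR mult_INR (plus_INR M) (mult_INR 2) /=; ring.
have mC : INR m <= C * (lm + l).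
  have : 0 <= INR N * lm by apply: Rmult_le_pos; lra.
  have : INR N * 6 <= INR N * l by apply: Rmult_le_compat_l.
  rewrite Em /C; lra.
have m1 : 1 <= INR m.
  have : 0 <= INR N * l by apply: Rmult_le_pos; lra.
  rewrite Em; lra.
have zb : INR m * / INR k <= C * (mu + nu) * / y.
  apply: (Rmult_le_reg_r (INR k * y * y)); first by repeat apply: Rmult_lt_0_compat.
  rewrite (_ : INR m * / INR k * _ = INR m * INR n); last by rewrite ny; field; lra.
  rewrite (_ : C * (mu + nu) * / y * _ = C * INR k * (y * (mu + nu))); last by field; lra.
  rewrite -munu.
  apply: (Rle_trans _ (C * (lm + l) * (INR k * l))).
    by apply: Rmult_le_compat => //; lra.
  lra.
have b18 : C * (mu + nu) <= C * 18 by apply: Rmult_le_compat_l; lra.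
have b0 : 0 <= C * (mu + nu).
  by apply: Rmult_le_pos; have := Rinv_0_lt_compat _ y0; lra.
have z0 : 0 <= INR m * / INR k by apply/Rlt_le/Rdiv_lt_0_compat; lra.
have z2 : INR m * / INR k <= / 2.
  apply: Rle_trans zb _; apply: (Rle_trans _ (C * 18 * / y)).
    by apply: Rmult_le_compat_r => //; apply/Rlt_le/Rinv_0_lt_compat.
  apply/(Rle_div_l _ _ _ y0); lra.
(* The left side is n(m/k)^2, the square of sqrt n times m/k. *)
have az : w * INR m * (INR m * / INR k) <= (C * (mu + nu)) ^ 2.
  rewrite (_ : _ * _ = (y * (INR m * / INR k)) ^ 2).
    apply: pow_incr; split; first by apply: Rmult_le_pos; lra.
    rewrite Rmult_comm; apply/(Rle_div_r _ _ _ y0); exact: zb.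
  rewrite /w ny; field; lra.
have wm : 1 <= w * INR m.
  by rewrite -[1]Rmult_1_r; apply: Rmult_le_compat; lra.
have az0 : 0 <= w * INR m * (INR m * / INR k) by apply: Rmult_le_pos; lra.
have mk : (m < k)%nat.
  apply: INR_lt; have := proj1 (Rle_div_l _ _ _ k0) z2; lra.
have m0 : (0 < m)%nat by apply: INR_lt; rewrite /=; lra.
have ks : INR k * (q / (1 - q)) <= 2 * lm.
  rewrite (_ : _ * _ = lm * / (1 - q)); last by rewrite /lm; field; lra.
  rewrite (Rmult_comm 2); apply: Rmult_le_compat_l; first lra.
  rewrite -(Rinv_inv 2); apply: Rinv_le_contravar; lra.
set P := (C * (mu + nu)) ^ (2 * S N).
have HB : forall J, sum_f_R0 (fun i => neg_binom_coef w (INR m) (S N + i) * (/ INR k) ^ (S N + i)) J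
    <= Rabs V * P.
  move=> J; apply: Rle_trans (HV w (INR m) (/ INR k) J _ _ wm z2 _) _.
  - lra.
  - by apply/Rlt_le/Rinv_0_lt_compat.
  - by apply: Rle_trans az _; apply: pow_incr; lra.
  apply: (Rle_trans _ (Rabs V * (w * INR m * (INR m * / INR k)) ^ S N)).
    by apply: Rmult_le_compat_r; [apply: pow_le|apply: Rle_abs].
  apply: Rmult_le_compat_l => //; rewrite /P pow_mult; exact: pow_incr.
have := Snk_sub_be_partial_sum_le n k N r0 m (Rabs V * P) Hn (conj m0 mk).
rewrite -/w -/q => H.
apply: Rle_trans (H _ _ _ HB) _; [rewrite /r0 /m; lia|rewrite /r0; lia|lra|].
have q1k : 0 <= (1 - q) ^ k by apply: pow_le; lra.
rewrite [X in _ <= X](_ : _ =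
  (1 - q) ^ k * ((Rabs V * (C ^ (2 * S N) * W) + 1) * mu ^ (2 * N + 1))); last ring.
apply: Rmult_le_compat_l => //.
rewrite Rmult_plus_distr_r; apply: Rplus_le_compat.
  rewrite Rmult_assoc; apply: Rmult_le_compat_l => //.
  rewrite /P Rpow_mult_distr Rmult_assoc; apply: Rmult_le_compat_l; first by apply: pow_le; lra.
  by apply: HW; rewrite ?yi; lra.
rewrite Rmult_1_l; apply: (Rle_trans _ ((/ y) ^ (2 * N + 1))).
  rewrite -(Rpower_pow _ _ (Rinv_0_lt_compat _ y0)) /Rpower -yi ln_exp.
  apply: exp_nondecreasing; rewrite plus_INR mult_INR Er /=; lra.
apply: pow_incr; split; [by apply/Rlt_le/Rinv_0_lt_compat|exact: mu_lo].
Qed.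

Theorem theorem6 :
  forall N : nat,
  exists K : R,
  forall c : nat -> R -> R -> R, be_expansion c ->
  forall n k : nat,
    (0 < n)%nat -> (0 < k)%nat ->
    INR n / ln (INR n) <= INR k ->
    INR k <= 2 * INR n / (ln (INR n) + 6) ->
    Rabs (Snk n k
          - sum_f_R0 (fun j : nat =>
              (-1) ^ j * Binomial.C k j * (lam n k / INR k) ^ j
              * sum_f_R0 (fun m : nat =>
                  c m (INR j) (INR n / INR k) / INR k ^ m) N) k)
    <= K * ((1 - lam n k / INR k) ^ k
            * (lam n k * ln (INR n) / sqrt (INR n)) ^ (2 * N + 1)).
Proof.
move=> N; have [K1 [n0 HK1]] := Snk_remainder_large N.
pose q n k := exp (- (INR n / INR k)).
pose f n k := Rabs (Snk n k - sum_f_R0 (fun j => (-1) ^ j * Binomial.C k j * q n k ^ j *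
                be_partial_sum N (INR j) (INR n / INR k) (/ INR k)) k).
pose g n k := (1 - q n k) ^ k * (INR k * q n k * ln (INR n) / sqrt (INR n)) ^ (2 * N + 1).
have [p Hp] := nat_ceil (Rmax n0 0) (Rmax_r _ _).
have [K2 HK2] := finite_ratio_bound f g p.
exists (Rmax K1 K2) => c Hc n k Hn Hk H1 H2.
have n1 : 0 < INR n by apply: lt_0_INR.
have k0 : 0 < INR k by apply: lt_0_INR.
have [l6 [wl _]] := regime_bounds n k Hn Hk H1 H2.
have -> : lam n k / INR k = q n k by rewrite /lam /q; field; lra.
have -> : lam n k = INR k * q n k by [].
(* Uniqueness of the expansion replaces [c] by [be_coef], so the constant does not depend on [c]. *)
rewrite (sum_eq _ (fun j => (-1) ^ j * Binomial.C k j * q n k ^ j *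
   be_partial_sum N (INR j) (INR n / INR k) (/ INR k))); last first.
  move=> j _; congr (_ * _); apply: sum_eq => m _.
  by rewrite (be_expansion_unique _ _ Hc be_coef_expansion) pow_inv.
rewrite -/(f n k) -/(g n k).
(* Positivity makes the maximum of finitely many ratios f/g a valid constant for small n. *)
have g0 : 0 < g n k.
  have q1 : q n k < 1 by rewrite -exp_0; apply: exp_increasing; lra.
  have q0 : 0 < q n k by exact: exp_pos.
  apply: Rmult_lt_0_compat; apply: pow_lt; first lra.
  apply: Rdiv_lt_0_compat; last exact: sqrt_lt_R0.
  by repeat apply: Rmult_lt_0_compat => //; lra.
have m1 := Rmax_l n0 0; have mK1 := Rmax_l K1 K2; have mK2 := Rmax_r K1 K2.
apply: (Rle_trans _ (Rmax (K1 * g n k) (K2 * g n k))); last first.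
  by apply: Rmax_lub; apply: Rmult_le_compat_r; lra.
case: (Rle_lt_dec n0 (INR n)) => Hn0.
  by apply: Rle_trans (Rmax_l _ _); apply: HK1.
apply: Rle_trans (Rmax_r _ _); apply: HK2 => //.
  by apply: INR_lt; lra.
apply: INR_lt.
(* k < n also holds here, so both indices lie below [p]. *)
have := proj2 (Rle_div_r _ _ _ k0) wl.
have := Rmult_le_compat_l (INR k) 6 (ln (INR n)) (Rlt_le _ _ k0) l6.
lra.
Qed.
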